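(* Let $B$ be the spectral scale of $b_1,\dots,b_n$ relative to $\tau$. The following statements hold. (1) If $\mathbf x$ is an isolated extreme point of $B$, then there is a central projection $p\in N$ such that $\mathbf x=\Psi(p)$. (2) If $N$ is finite-dimensional and $\mathbf x$ is an extreme point of $B$, then $\mathbf x=\Psi(p)$ for some central projection $p\in N$ if and only if $\mathbf x$ is an isolated extreme point of $B$.
   Context: $M$ is a finite von Neumann algebra with a faithful normal tracial state $\tau$, $n$ is a positive integer, and $b_1,\dots,b_n\in M$ are self-adjoint; $N$ is the von Neumann subalgebra of $M$ generated by $b_1,\dots,b_n$ and $1$. $M_1^+=\{a\in M:0\le a\le 1\}$, $\Psi(a)=(\tau(a),\tau(b_1a),\dots,\tau(b_na))$, and $B=\Psi(M_1^+)\subset\mathbb R^{n+1}$ is the spectral scale, a compact convex set. An isolated extreme point of a convex set $C$ is an extreme point of $C$ that is isolated in the set of all extreme points of $C$. A central projection in $N$ is a projection lying in the center of $N$. *)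

(* Defs.v *)
From HB Require Import structures.
From mathcomp Require Import all_boot all_order all_algebra.
From mathcomp Require Export complex.
From mathcomp Require Import all_classical all_reals all_analysis.

Set Implicit Arguments.
Unset Strict Implicit.
Unset Printing Implicit Defensive.

Import Order.TTheory GRing.Theory Num.Theory.
Import numFieldNormedType.Exports.

Local Open Scope classical_set_scope.
Local Open Scope ring_scope.
Local Open Scope complex_scope.

(* Von Neumann algebras are concrete: sets of bounded operators on a complex
   Hilbert space. A Hilbert space is a complete normed R[i]-module H with a
   positive definite Hermitian form ip (linear on the left) inducing its norm,
   forall x, ip x x = `|x| ^+ 2. Operators are plain functions H -> H, with the
   pointwise vector space structure and with composition as product. *)
Section Operators.
Variables (R : realType) (H : completeNormedModType R[i]).
Variable ip : {dot H for Num.conj}.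

Definition bounded_operator : set (H -> H) :=
  [set a | linear a /\ continuous a].

Definition adjoint (a a' : H -> H) := forall x y, ip (a x) y = ip x (a' y).

Definition selfadjoint (a : H -> H) := adjoint a a.

(* The order of R[i] only compares numbers with the same imaginary part, so
   op_le 0 a says that every ip (a x) x is real and nonnegative. *)
Definition op_le (a b : H -> H) := forall x, ip (a x) x <= ip (b x) x.

Definition commutant (S : set (H -> H)) : set (H -> H) :=
  [set a | bounded_operator a /\ forall s, S s -> a \o s = s \o a].

(* A set equal to its bicommutant is a unital algebra of bounded operators, so
   only stability under adjoints remains to be required. *)
Definition von_neumann_algebra (M : set (H -> H)) :=
  (forall a, M a -> exists2 a', M a' & adjoint a a') /\
  commutant (commutant M) = M.

Definition von_neumann_subalgebra (M A : set (H -> H)) :=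
  von_neumann_algebra A /\ A `<=` M.

Definition generated_vna (M G : set (H -> H)) : set (H -> H) :=
  smallest (von_neumann_subalgebra M) (G `|` [set id]).

Definition finite_vna (M : set (H -> H)) :=
  forall v v', M v -> M v' -> adjoint v v' -> v' \o v = id -> v \o v' = id.

Definition finite_dim (A : set (H -> H)) :=
  exists k (e : 'I_k -> H -> H), (forall i, A (e i)) /\
    forall a, A a -> exists c : 'I_k -> R[i], a = \sum_i c i *: e i.

Definition projection (p : H -> H) := selfadjoint p /\ p \o p = p.

Definition central_projection (A : set (H -> H)) (p : H -> H) :=
  [/\ A p, projection p & forall a, A a -> p \o a = a \o p].

Definition selfadjoint_part (M : set (H -> H)) : set (H -> H) :=
  [set a | M a /\ selfadjoint a].

Definition op_lub (M D : set (H -> H)) (a : H -> H) :=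
  [/\ selfadjoint_part M a, forall d, D d -> op_le d a &
    forall c, selfadjoint_part M c -> (forall d, D d -> op_le d c) ->
      op_le a c].

Definition upward_directed (D : set (H -> H)) :=
  D !=set0 /\
  forall d1 d2, D d1 -> D d2 ->
    exists d, [/\ D d, op_le d1 d & op_le d2 d].

(* Linear functionals on M are functions on all of H -> H of which only the
   values on M matter. *)
Section Functionals.
Variables (M : set (H -> H)) (tau : (H -> H) -> R[i]).

Definition state :=
  [/\ forall c a b, M a -> M b -> tau (c *: a + b) = c * tau a + tau b,
      forall a, M a -> op_le 0 a -> 0 <= tau a & tau id = 1].

Definition tracial := forall a b, M a -> M b -> tau (a \o b) = tau (b \o a).

Definition faithful := forall a, M a -> op_le 0 a -> tau a = 0 -> a = 0.

(* The range of an increasing net is an upward directed set. *)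
Definition normal := forall D a,
  D `<=` selfadjoint_part M -> upward_directed D -> op_lub M D a ->
  supremums [set tau d | d in D] (tau a).

Definition faithful_normal_tracial_state :=
  [/\ state, tracial, faithful & normal].

Definition positive_unit_ball : set (H -> H) :=
  [set a | [/\ M a, op_le 0 a & op_le a id]].

(* For selfadjoint a and b in M, the numbers tau a and tau (b \o a) are real,
   as tau is tracial; Re only changes their type. *)
Definition spectral_map n (b : 'I_n -> H -> H) (a : H -> H) : 'rV[R]_n.+1 :=
  \row_j complex.Re (tau (if unlift ord0 j is Some i then b i \o a else a)).

Definition spectral_scale n (b : 'I_n -> H -> H) : set 'rV[R]_n.+1 :=
  [set spectral_map b a | a in positive_unit_ball].

End Functionals.
End Operators.

Definition extreme_points (R : realType) (V : lmodType R) (C : set V) : set V :=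
  [set x | C x /\ forall y z t, C y -> C z -> 0 < t < 1 ->
     x = t *: y + (1 - t) *: z -> y = x /\ z = x].

(* Main.v *)
Require Import Defs.
From HB Require Import structures.
From mathcomp Require Import all_boot all_order all_algebra complex.
From mathcomp Require Import all_classical all_reals all_analysis.
From mathcomp Require Import ring lra.
Import Order.TTheory GRing.Theory Num.Theory.
Import numFieldNormedType.Exports.
Local Open Scope classical_set_scope.
Local Open Scope ring_scope.
Local Open Scope complex_scope.

Set Implicit Arguments.
Unset Strict Implicit.
Unset Printing Implicit Defensive.

(** Write [tr] for the real part of the trace, [A_1] for the unit interval of an
    algebra [A], [N] for the algebra generated by the [b_i], and [c_u] for the
    combination of [1, b_1, ..., b_n] with coefficients [u], so that the linear
    form with coefficients [u] takes the value [tr (c_u a)] at [Psi a].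

    An extreme point of the spectral scale of an algebra [A] is [Psi p] for a
    projection [p]: if [0 <= a <= 1], then [Psi a] is the midpoint of
    [Psi (a^2)] and [Psi (2 a - a^2)], so [tr (a - a^2) = 0] and [a = a^2] since
    the trace is faithful ([extreme_idem]). If [a] maximizes [tr (c a)] on
    [A_1] for some selfadjoint [c] in [A], then the first variation along the
    skew element [k = a c - c a] is [tr (k^2)]; it vanishes, so [a] and [c]
    commute ([maximizer_commutes]).

    The scale is compact ([scale_compact]). Since it lives in a
    finite-dimensional space, boundedness and closedness suffice, and closedness
    follows by a minimal norm argument from the completeness of [A_1] for the
    norm [tr (a^2)^(1/2)] ([unit_ball_complete]). Completeness is where normality
    enters: the tails of a fast Cauchy sequence are dominated by elements [T_m]
    of [A_1] of small trace, obtained from sums [X] of squares as suprema of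
    [X (1 + X)^-1] ([vna_damping], [tail_bound]).

    The scales of [M] and [N] coincide ([spectral_scale_sub]). Being compact and
    convex they are compared through their support functions: the maximum of
    [tr (c_u a)] on [N_1] is attained at a projection [p] of [N] commuting with
    [c_u], and then [c_u p] is positive and [c_u (1 - p)] negative when tested
    against [N_1]; an argument with powers extends this to the unit interval of
    [M] ([subalgebra_positive]), which makes [p] a maximizer there too. This
    replaces both spectral projections and the conditional expectation.

    Let [Psi p] be an isolated extreme point. It is strictly separated from the
    other extreme points, because in finite dimension the slices at an extreme
    point form a base of neighbourhoods ([extreme_slice]). Hence it maximizes the
    linear forms with coefficients [u] in an open set ([isolated_exposed]), so [p]
    commutes with these [c_u], hence with every [b_i], and [p] is central in [N]
    ([isolated_central]).

    Conversely let [p] be a central projection of [N] with [Psi p] extreme. If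
    [Psi q] is an extreme point close to [Psi p], then the midpoint [m] of [p] and
    [q] has an image close to an extreme point, so [tr (m - m^2)] is small
    ([extreme_midpoint]); this number is [tr ((p - q)^2) / 4], and [(p - q)^2] is a
    projection because [p] is central. If [N] is finite-dimensional, the traces
    of its nonzero projections are bounded below ([finite_dim_trace_gap]), so
    [q = p] ([central_isolated]). *)

(** * The real inner product *)

Section RealInnerProduct.
Context {R : realType} {H : completeNormedModType R[i]}.
Variable ip : {dot H for Num.conj}.
Hypothesis ip_norm : forall x : H, ip x x = `|x| ^+ 2.
Implicit Types (x y z : H) (r : R).

Definition re_ip x y : R := complex.Re (ip x y).
Local Notation rip := re_ip.

Definition sqnorm x : R := rip x x.
Local Notation nsq := sqnorm.

Lemma ReD (u v : R[i]) : complex.Re (u + v) = complex.Re u + complex.Re v.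
Proof. by case: u => ? ?; case: v. Qed.

Lemma ReN (u : R[i]) : complex.Re (- u) = - complex.Re u.
Proof. by case: u. Qed.

Lemma ReZ r (u : R[i]) : complex.Re (r%:C * u) = r * complex.Re u.
Proof. by case: u => a b /=; rewrite mul0r subr0. Qed.

Lemma ipC x y : ip y x = conjc (ip x y).
Proof. by rewrite (hermC ip y x) expr0 mul1r. Qed.

Lemma ripDl x y z : rip (x + y) z = rip x z + rip y z.
Proof. by rewrite /rip linearDl ReD. Qed.

Lemma ripC x y : rip x y = rip y x.
Proof. by rewrite /rip ipC; case: (ip y x). Qed.

Lemma ripDr x y z : rip x (y + z) = rip x y + rip x z.
Proof. by rewrite ripC ripDl !(ripC x). Qed.

Lemma ripNl x y : rip (- x) y = - rip x y.
Proof. by rewrite /rip linearNl ReN. Qed.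

Lemma ripNr x y : rip x (- y) = - rip x y.
Proof. by rewrite ripC ripNl ripC. Qed.

Lemma ripZl r x y : rip (r%:C *: x) y = r * rip x y.
Proof. by rewrite /rip linearZl_LR ReZ. Qed.

Lemma ripZr r x y : rip x (r%:C *: y) = r * rip x y.
Proof. by rewrite ripC ripZl ripC. Qed.

Lemma rip0l x : rip 0 x = 0.
Proof. by rewrite /rip linear0l. Qed.

Lemma rip0r x : rip x 0 = 0.
Proof. by rewrite ripC rip0l. Qed.

Definition ripE := (ripDl, ripDr, ripNl, ripNr, ripZl, ripZr, rip0l, rip0r).

Definition nrm x : R := complex.Re `|x|.

Lemma nrmE x : `|x| = (nrm x)%:C.
Proof. by rewrite /nrm RRe_real // normr_real. Qed.

Lemma nrm_ge0 x : 0 <= nrm x.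
Proof. by rewrite -ler0c -nrmE. Qed.

Lemma nsq_nrm x : nsq x = nrm x ^+ 2.
Proof. by rewrite /nsq /rip ip_norm nrmE -rmorphXn. Qed.

Lemma nsq_ge0 x : 0 <= nsq x.
Proof. by rewrite nsq_nrm sqr_ge0. Qed.

Lemma nrmD x y : nrm (x + y) <= nrm x + nrm y.
Proof. by rewrite -lecR rmorphD /= -!nrmE ler_normD. Qed.

Lemma nrm_le x r : 0 <= r -> nsq x <= r ^+ 2 -> nrm x <= r.
Proof. by move=> r0; rewrite nsq_nrm ler_sqr ?nnegrE ?nrm_ge0. Qed.

Lemma nsq0_eq0 x : nsq x = 0 -> x = 0.
Proof.
rewrite nsq_nrm => /eqP; rewrite sqrf_eq0 => /eqP h.
by apply/eqP; rewrite -normr_eq0 nrmE h.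
Qed.

Lemma nsqN x : nsq (- x) = nsq x.
Proof. by rewrite /nsq ripNl ripNr opprK. Qed.

Lemma nsqD x y : nsq (x + y) = nsq x + 2 * rip x y + nsq y.
Proof. by rewrite /nsq !ripE (ripC y x); ring. Qed.

Lemma nsqB x y : nsq (x - y) = nsq x - 2 * rip x y + nsq y.
Proof. by rewrite /nsq !ripE (ripC y x); ring. Qed.

Lemma nsqD_le x y : nsq (x + y) <= 2 * nsq x + 2 * nsq y.
Proof. by have := nsq_ge0 (x - y); rewrite nsqB nsqD; lra. Qed.

Lemma nsqZ r x : nsq (r%:C *: x) = r ^+ 2 * nsq x.
Proof. by rewrite /nsq !ripE; ring. Qed.

(** The common source of the Cauchy-Schwarz inequalities below; the polynomial
    may be degenerate, since the forms may vanish. *)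
Lemma discr_le (a b c : R) : 0 <= c ->
  (forall s, 0 <= a + 2 * s * b + s ^+ 2 * c) -> b ^+ 2 <= a * c.
Proof.
move=> c0 h; have [c1|c1] := eqVneq c 0.
  have [->|b0] := eqVneq b 0; first by rewrite c1; lra.
  have := h (- (a + 1) / (2 * b)); rewrite c1 mulr0 addr0.
  have -> : 2 * (- (a + 1) / (2 * b)) * b = - (a + 1).
    by field.
  by lra.
have cp : 0 < c by rewrite lt_def c1.
have := h (- b / c).
have -> : a + 2 * (- b / c) * b + (- b / c) ^+ 2 * c = (a * c - b ^+ 2) / c.
  by field.
by rewrite pmulr_lge0 ?invr_gt0 // subr_ge0.
Qed.

Lemma rip_CS x y : rip x y ^+ 2 <= nsq x * nsq y.
Proof.
apply: discr_le (nsq_ge0 y) _ => s.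
suff <- : nsq (x + s%:C *: y) = nsq x + 2 * s * rip x y + s ^+ 2 * nsq y.
  exact: nsq_ge0.
by rewrite nsqD nsqZ ripZr; ring.
Qed.

Lemma rip_ext x y : (forall z, rip x z = rip y z) -> x = y.
Proof.
move=> h; apply/eqP; rewrite -subr_eq0; apply/eqP/nsq0_eq0.
by rewrite /nsq ripDl ripNl h subrr.
Qed.

(** Real parts determine the complex inner product, so that selfadjointness can
    be checked on them. *)
Lemma ip_ripE x y : ip x y = Complex (rip x y) (rip x ('i%C *: y)).
Proof.
have -> : rip x ('i%C *: y) = complex.Re (conjc 'i%C * ip x y).
  by rewrite /rip linearZr_LR.
rewrite /rip; case: (ip x y) => a b /=.
by congr Complex; ring.
Qed.

(** Convergence in [H] is handled through squared norms, so that all estimates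
    take place in the real field. *)
Definition tendsto (u : nat -> H) x :=
  forall e : R, 0 < e -> exists n, forall m, (n <= m)%N -> nsq (u m - x) < e.
Local Notation tends := tendsto.

Definition cauchy_seq (u : nat -> H) :=
  forall e : R, 0 < e -> exists n, forall k m, (n <= k)%N -> (k <= m)%N ->
    nsq (u m - u k) < e.
Local Notation cauchy_nsq := cauchy_seq.

Lemma cauchy_tends u : cauchy_nsq u -> exists x, tends u x.
Proof.
move=> cu.
have nlt x e : 0 < e -> nsq x < e ^+ 2 -> `|x| < e%:C.
  move=> e0; rewrite nsq_nrm nrmE ltcR => h.
  by rewrite -(ltr_pXn2r (n := 2)) // ?nnegrE ?nrm_ge0 // ltW.
have cvu : cvg (u @ \oo).
  apply/cauchy_cvgP/cauchy_exP => e e0.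
  have eE : e = (complex.Re e)%:C by rewrite RRe_real // gtr0_real.
  have e0' : 0 < complex.Re e by rewrite -ltcR -eE.
  have [n hn] := cu _ (exprn_gt0 2 e0').
  exists (u n); exists n => // m /= nm.
  rewrite -ball_normE /= distrC eE; apply: nlt => //.
  by apply: hn.
exists (lim (u @ \oo)) => e e0.
have s0 : 0 < Num.sqrt e by rewrite sqrtr_gt0.
have := cvu; move/cvgrPdist_lt => /(_ (Num.sqrt e)%:C).
rewrite ltcR s0 => /(_ isT) [n _ hn].
exists n => m nm; have := hn m nm.
rewrite distrC nrmE ltcR => h.
rewrite nsq_nrm -[ltRHS]sqr_sqrtr ?(ltW e0) //.
by rewrite ltr_pXn2r // ?nnegrE ?nrm_ge0 // ltW.
Qed.

Lemma tends_uniq u x y : tends u x -> tends u y -> x = y.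
Proof.
move=> hx hy; apply/eqP; rewrite -subr_eq0; apply/eqP/nsq0_eq0.
apply/eqP; rewrite eq_le nsq_ge0 andbT; apply/ler_addgt0Pl => e e0.
rewrite addr0.
have e4 : 0 < e / 4 by lra.
have [n hn] := hx _ e4; have [m hm] := hy _ e4.
have /ltW h1 := hn _ (leq_maxl n m); have /ltW h2 := hm _ (leq_maxr n m).
set w := u _ in h1 h2.
have -> : x - y = (w - y) + - (w - x) by rewrite opprB [RHS]addrC subrKA.
apply: le_trans (nsqD_le _ _) _.
rewrite nsqN; lra.
Qed.

Lemma tends_ripB u x y : tends u x -> forall e : R, 0 < e ->
  exists n, forall m, (n <= m)%N -> `|rip (u m) y - rip x y| <= e.
Proof.
move=> hu e e0.
have p0 : 0 < e ^+ 2 / (nsq y + 1).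
  by rewrite divr_gt0 ?exprn_gt0 // ltr_wpDl ?nsq_ge0.
have [n hn] := hu _ p0; exists n => m /hn.
set w := u _; rewrite ltr_pdivlMr ?ltr_wpDl ?nsq_ge0 // => h1.
rewrite -ripNl -ripDl.
rewrite -ler_sqr ?nnegrE ?normr_ge0 ?(ltW e0) // real_normK ?num_real //.
apply: le_trans (rip_CS (w - x) y) _; apply: le_trans (ltW h1).
by apply: ler_wpM2l; rewrite ?nsq_ge0 // lerDl.
Qed.

Lemma tends_rip u x y r : tends u x ->
  (exists N, forall m, (N <= m)%N -> rip (u m) y <= r) -> rip x y <= r.
Proof.
move=> hu [N hN]; apply/ler_addgt0Pl => e e0.
have [n hn] := tends_ripB y hu e0.
have := hN _ (leq_maxr n N); have := hn _ (leq_maxl n N).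
rewrite ler_norml => /andP[]; lra.
Qed.

Lemma tends_nsq u x r : tends u x ->
  (exists N, forall m, (N <= m)%N -> nsq (u m) <= r) -> nsq x <= r.
Proof.
move=> hu [N hN].
have r0 : 0 <= r by apply: le_trans (hN _ (leqnn _)); exact: nsq_ge0.
have : rip x x <= (nsq x + r) / 2.
  apply: tends_rip hu _; exists N => m /hN h.
  by have := nsq_ge0 (u m - x); rewrite nsqB; lra.
rewrite -/(nsq x); lra.
Qed.

Lemma tends_comp u x : tends u x -> forall f, (exists C, forall y z,
  nsq (f y - f z) <= C * nsq (y - z)) -> tends (f \o u) (f x).
Proof.
move=> hu f [C hC] e e0.
have K0 : 0 < `|C| + 1 by rewrite ltr_wpDl.
have [n hn] := hu _ (divr_gt0 e0 K0).
exists n => m /hn; rewrite ltr_pdivlMr // => h.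
apply: le_lt_trans (hC _ _) _; apply: le_lt_trans h.
rewrite mulrC; apply: ler_wpM2l; first exact: nsq_ge0.
by apply: le_trans (ler_norm _) _; rewrite lerDl.
Qed.

Lemma tendsD u v x y : tends u x -> tends v y ->
  tends (fun k => u k + v k) (x + y).
Proof.
move=> hu hv e e0; have e4 : 0 < e / 4 by lra.
have [n hn] := hu _ e4; have [m hm] := hv _ e4.
exists (maxn n m) => k; rewrite geq_max => /andP[/hn h1 /hm h2].
rewrite opprD addrACA; apply: le_lt_trans (nsqD_le _ _) _; lra.
Qed.

End RealInnerProduct.

(** * Linear operators and their quadratic forms *)

Section Operators.
Context {R : realType} {H : completeNormedModType R[i]}.
Variable ip : {dot H for Num.conj}.
Hypothesis ip_norm : forall x : H, ip x x = `|x| ^+ 2.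
Local Notation rip := (re_ip ip).
Local Notation nsq := (sqnorm ip).
Implicit Types (x y z : H) (r : R) (a b c : H -> H) (A : set (H -> H)).

Section LinearMaps.
Variable a : H -> H.
Hypothesis la : linear a.

Lemma linD x y : a (x + y) = a x + a y.
Proof. by have := la 1 x y; rewrite !scale1r. Qed.

Lemma lin0 : a 0 = 0.
Proof. by apply: (addrI (a 0)); rewrite -linD !addr0. Qed.

Lemma linZ (k : R[i]) x : a (k *: x) = k *: a x.
Proof. by have := la k x 0; rewrite lin0 !addr0. Qed.

Lemma linN x : a (- x) = - a x.
Proof. by rewrite -scaleN1r linZ scaleN1r. Qed.

Lemma linB x y : a (x - y) = a x - a y.
Proof. by rewrite linD linN. Qed.

End LinearMaps.

Lemma sa_rip a x y : selfadjoint ip a -> rip (a x) y = rip x (a y).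
Proof. by move=> sa; rewrite /rip sa. Qed.

Lemma rip_sa a : linear a ->
  (forall x y, rip (a x) y = rip x (a y)) -> selfadjoint ip a.
Proof. by move=> la h x y; rewrite !ip_ripE !h linZ. Qed.

Lemma sa_Im a x : selfadjoint ip a -> complex.Im (ip (a x) x) = 0.
Proof.
move=> /(_ x x); rewrite (ipC ip (a x) x).
by case: (ip (a x) x) => u v [] /= h; lra.
Qed.

Lemma op_leP a b : selfadjoint ip a -> selfadjoint ip b ->
  op_le ip a b <-> forall x, rip (a x) x <= rip (b x) x.
Proof.
move=> sa sb; split=> h x; have := h x.
  by rewrite lecE => /andP[].
by rewrite lecE !sa_Im // eqxx.
Qed.

(** Polarization: on a complex Hilbert space a real quadratic form can only
    come from a selfadjoint operator. *)
Lemma pos_sa a : linear a -> op_le ip 0 a -> selfadjoint ip a.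
Proof.
move=> la a0 x y.
have im z : complex.Im (ip (a z) z) = 0.
  by have := a0 z; rewrite lecE /= linear0l => /andP[/eqP].
have h1 := im (x + y); have h2 := im (x + 'i%C *: y).
have hx := im x; have hy := im y.
have e1 : ip (a (x + y)) (x + y) =
    ip (a x) x + ip (a x) y + (ip (a y) x + ip (a y) y).
  by rewrite linD // linearDl !linearDr.
have e2 : ip (a (x + 'i%C *: y)) (x + 'i%C *: y) =
    ip (a x) x + conjc 'i%C * ip (a x) y +
    ('i%C * ip (a y) x + 'i%C * (conjc 'i%C * ip (a y) y)).
  by rewrite linD // linZ // linearDl !linearDr !linearZl_LR !linearZr_LR.
rewrite {}e1 in h1; rewrite {}e2 in h2; rewrite (ipC ip (a y) x).
move: hx hy h1 h2; case: (ip (a x) x) => x1 x2; case: (ip (a y) y) => y1 y2.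
case: (ip (a x) y) => u1 u2; case: (ip (a y) x) => v1 v2 /= *.
by congr Complex; lra.
Qed.

(** Cauchy-Schwarz for the form of [a], applied to [x] and [a x]. *)
Lemma pos_nsq a r x : linear a -> selfadjoint ip a -> 0 <= r ->
  (forall y, 0 <= rip (a y) y <= r * nsq y) -> nsq (a x) <= r * rip (a x) x.
Proof.
move=> la sa r0 h.
have /andP[q0 _] := h x; have /andP[c0 c1] := h (a x).
have := nsq_ge0 ip_norm (a x); rewrite le_eqVlt => /orP[/eqP <-|n0].
  by rewrite mulr_ge0.
have : (- nsq (a x)) ^+ 2 <= rip (a x) x * rip (a (a x)) (a x).
  apply: discr_le c0 _ => s; have /andP[+ _] := h (x - s%:C *: a x).
  rewrite linB // linZ // !ripE (sa_rip (a x) x sa) -/(nsq (a x)).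
  by congr (0 <= _); ring.
rewrite sqrrN expr2 => h1.
have : nsq (a x) * nsq (a x) <= (r * rip (a x) x) * nsq (a x).
  apply: le_trans h1 _; rewrite mulrAC [leRHS]mulrC.
  by apply: ler_wpM2l.
by rewrite ler_pM2r.
Qed.

Lemma bounded_continuous a r : linear a ->
  (forall x, nsq (a x) <= r ^+ 2 * nsq x) -> 0 <= r -> continuous a.
Proof.
move=> la h r0.
pose f : {linear H -> H} :=
  HB.pack a (GRing.isLinear.Build R[i] H H _ a la).
apply: (@bounded_linear_continuous _ _ _ f).
apply/linear_boundedP; exists r%:C; split; first by apply/complex_realP; exists r.
move=> K rK x; apply: le_trans (ler_wpM2r (normr_ge0 _) (ltW rK)).
rewrite !nrmE -rmorphM lecR; apply: (nrm_le ip_norm).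
  by rewrite mulr_ge0 // nrm_ge0.
by rewrite exprMn -(nsq_nrm ip_norm).
Qed.

Lemma continuous_bounded a : linear a -> continuous a ->
  exists2 r, 0 <= r & forall x, nsq (a x) <= r * nsq x.
Proof.
move=> la ca.
pose f : {linear H -> H} :=
  HB.pack a (GRing.isLinear.Build R[i] H H _ a la).
have /linear_bounded_continuous/linear_boundedP : continuous f by [].
move=> /pinfty_ex_gt0[k k0 h].
have kE : k = (complex.Re k)%:C by rewrite RRe_real // gtr0_real.
exists (complex.Re k ^+ 2); first exact: sqr_ge0.
move=> x; have := h x; rewrite kE !nrmE -rmorphM lecR => hx.
rewrite !(nsq_nrm ip_norm) -exprMn ler_sqr ?nnegrE ?nrm_ge0 //.
by apply: le_trans hx; exact: nrm_ge0.
Qed.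

Lemma sa_bounded a : linear a -> continuous a -> selfadjoint ip a ->
  exists2 r, 0 < r & forall x, - (r * nsq x) <= rip (a x) x <= r * nsq x.
Proof.
move=> la ca sa; have [r r0 h] := continuous_bounded la ca.
exists (r + 1); first lra.
move=> x; have := h x.
have n0 := nsq_ge0 ip_norm x.
have h1 := nsq_ge0 ip_norm (a x + x); have h2 := nsq_ge0 ip_norm (a x - x).
rewrite nsqD in h1; rewrite nsqB in h2 => h0; rewrite mulrDl mul1r.
have := mulr_ge0 r0 n0.
by move=> h3; apply/andP; split; lra.
Qed.

End Operators.

(** * Von Neumann algebras and strong limits *)

Section Algebras.
Context {R : realType} {H : completeNormedModType R[i]}.
Variable ip : {dot H for Num.conj}.
Hypothesis ip_norm : forall x : H, ip x x = `|x| ^+ 2.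
Local Notation rip := (re_ip ip).
Local Notation nsq := (sqnorm ip).
Local Notation tends := (tendsto ip).
Local Notation cauchy_nsq := (cauchy_seq ip).
Implicit Types (x y z : H) (r : R) (a b c : H -> H) (A : set (H -> H)).

Lemma commutant_bounded A a : commutant A a -> bounded_operator a.
Proof. by case. Qed.

Lemma commutantE A a s x : commutant A a -> A s -> a (s x) = s (a x).
Proof. by case=> _ /(_ s) h /h e; have := congr1 (@^~ x) e. Qed.

Lemma commutantI A a : linear a -> continuous a ->
  (forall s, A s -> forall x, a (s x) = s (a x)) -> commutant A a.
Proof. by move=> la ca h; split=> // s As; apply/funext => x; exact: h. Qed.

Section CommutantAlgebra.
Variable A : set (H -> H).
Hypothesis Alin : forall s, A s -> linear s.

Lemma commutant_id : commutant A id.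
Proof. by apply: commutantI => // x. Qed.

Lemma commutant0 : commutant A 0.
Proof.
apply: commutantI => [k u v|x|s As x].
- by rewrite scaler0 addr0.
- exact: cst_continuous.
- by rewrite (lin0 (Alin As)).
Qed.

Lemma commutantP (k : R[i]) a b : commutant A a -> commutant A b ->
  commutant A (k *: a + b).
Proof.
move=> ca cb; have [la cta] := commutant_bounded ca.
have [lb ctb] := commutant_bounded cb.
apply: commutantI => [l u v|x|s As x].
- rewrite !fctE !la !lb !scalerDr !scalerA (mulrC k l).
  by rewrite addrACA.
- apply: cvgD; last exact: ctb.
  by apply: cvgZr; exact: cta.
- by rewrite !fctE (linD (Alin As)) (linZ (Alin As)) (commutantE _ ca) //
    (commutantE _ cb).
Qed.

Lemma commutantM a b : commutant A a -> commutant A b ->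
  commutant A (a \o b).
Proof.
move=> ca cb; have [la cta] := commutant_bounded ca.
have [lb ctb] := commutant_bounded cb.
apply: commutantI => [l u v|x|s As x].
- by rewrite /= lb la.
- by apply: continuous_comp; [exact: ctb|exact: cta].
- by rewrite /= (commutantE _ cb) // (commutantE _ ca).
Qed.

End CommutantAlgebra.

Section Algebra.
Variable A : set (H -> H).
Hypothesis vA : von_neumann_algebra ip A.

Let bicomm : commutant (commutant A) = A := proj2 vA.

Let commA_lin s : commutant A s -> linear s.
Proof. by case=> -[]. Qed.

Lemma vna_lin a : A a -> linear a.
Proof. by rewrite -bicomm => /commutant_bounded[]. Qed.

Lemma vna_continuous a : A a -> continuous a.
Proof. by rewrite -bicomm => /commutant_bounded[]. Qed.

Lemma vna_id : A id.
Proof. by rewrite -bicomm; exact: commutant_id. Qed.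

Lemma vna0 : A 0.
Proof. by rewrite -bicomm; exact: commutant0. Qed.

Lemma vnaP (k : R[i]) a b : A a -> A b -> A (k *: a + b).
Proof. by rewrite -bicomm; exact: commutantP. Qed.

Lemma vnaM a b : A a -> A b -> A (a \o b).
Proof. by rewrite -bicomm; exact: commutantM. Qed.

Lemma vnaZ (k : R[i]) a : A a -> A (k *: a).
Proof. by move=> Aa; rewrite -[_ *: _]addr0; apply: vnaP => //; exact: vna0. Qed.

Lemma vnaD a b : A a -> A b -> A (a + b).
Proof. by move=> Aa Ab; rewrite -[a]scale1r; exact: vnaP. Qed.

Lemma vnaN a : A a -> A (- a).
Proof. by move=> Aa; rewrite -scaleN1r; exact: vnaZ. Qed.

Lemma vnaB a b : A a -> A b -> A (a - b).
Proof. by move=> Aa Ab; apply: vnaD => //; exact: vnaN. Qed.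

Lemma vnaI a : linear a -> continuous a ->
  (forall s, commutant A s -> forall x, a (s x) = s (a x)) -> A a.
Proof. by move=> la ca h; rewrite -bicomm; exact: commutantI. Qed.

(** Elements of [A] are handled through their selfadjoint ones, for which all
    order relations are inequalities between real quadratic forms. *)
Local Notation Asa := (selfadjoint_part ip A).
Local Notation A1 := (positive_unit_ball ip A).

Lemma saA a : Asa a -> A a. Proof. by case. Qed.
Lemma sa_adj a : Asa a -> selfadjoint ip a. Proof. by case. Qed.
Lemma sa_lin a : Asa a -> linear a. Proof. by case=> /vna_lin. Qed.

Lemma saI a : A a -> (forall x y, rip (a x) y = rip x (a y)) -> Asa a.
Proof. by move=> Aa h; split=> //; apply: rip_sa => //; exact: vna_lin. Qed.

Lemma saE a x y : Asa a -> rip (a x) y = rip x (a y).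
Proof. by move=> [_ sa]; exact: sa_rip. Qed.

Lemma sa_id : Asa id. Proof. by split=> //; exact: vna_id. Qed.

Lemma sa0 : Asa 0.
Proof.
by apply: saI => [|x y]; [exact: vna0|rewrite rip0l rip0r].
Qed.

Lemma saZ r a : Asa a -> Asa (r%:C *: a).
Proof.
move=> ha; apply: saI => [|x y]; first by apply: vnaZ; exact: saA.
by rewrite !fctE ripZl ripZr (saE _ _ ha).
Qed.

Lemma saD a b : Asa a -> Asa b -> Asa (a + b).
Proof.
move=> ha hb; apply: saI => [|x y]; first by apply: vnaD; exact: saA.
by rewrite !fctE ripDl ripDr (saE _ _ ha) (saE _ _ hb).
Qed.

Lemma saN a : Asa a -> Asa (- a).
Proof.
move=> ha; apply: saI => [|x y]; first by apply: vnaN; exact: saA.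
by rewrite !fctE ripNl ripNr (saE _ _ ha).
Qed.

Lemma saB a b : Asa a -> Asa b -> Asa (a - b).
Proof. by move=> ha hb; apply: saD => //; exact: saN. Qed.

Lemma sa_conj a b : Asa a -> Asa b -> Asa (a \o b \o a).
Proof.
move=> ha hb; apply: saI => [|x y].
  exact: vnaM (vnaM (saA ha) (saA hb)) (saA ha).
by rewrite /= (saE _ _ ha) (saE _ _ hb) (saE _ _ ha).
Qed.

Lemma saM a b : Asa a -> Asa b -> a \o b = b \o a -> Asa (a \o b).
Proof.
move=> ha hb e; apply: saI => [|x y].
  exact: vnaM (saA ha) (saA hb).
by rewrite {2}e /= (saE _ _ ha) (saE _ _ hb).
Qed.

Lemma sa_sqr a : Asa a -> Asa (a \o a).
Proof. by move=> ha; exact: saM. Qed.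

Lemma vna_sa_bounded a : Asa a ->
  exists2 r, 0 < r & forall x, - (r * nsq x) <= rip (a x) x <= r * nsq x.
Proof.
by case=> Aa sa; apply: sa_bounded => //; [exact: vna_lin|exact: vna_continuous].
Qed.

Lemma unit_ballP a :
  A1 a <-> Asa a /\ forall x, 0 <= rip (a x) x <= nsq x.
Proof.
split=> [[Aa a0 a1]|[ha h]].
  have ha : Asa a by split=> //; apply: pos_sa => //; exact: vna_lin.
  split=> // x; apply/andP; split.
    by have /(op_leP (sa_adj sa0) (sa_adj ha))/(_ x) := a0; rewrite rip0l.
  by have /(op_leP (sa_adj ha) (sa_adj sa_id))/(_ x) := a1.
split; first exact: saA.
  apply/(op_leP (sa_adj sa0) (sa_adj ha)) => x; rewrite rip0l.
  by case/andP: (h x).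
apply/(op_leP (sa_adj ha) (sa_adj sa_id)) => x; by case/andP: (h x).
Qed.

Lemma unit_ball_nsq a x : A1 a -> nsq (a x) <= rip (a x) x.
Proof.
move=> /unit_ballP[ha h]; rewrite -[leRHS]mul1r; apply: pos_nsq => //.
- exact: sa_lin.
- exact: sa_adj.
- by move=> y; rewrite mul1r.
Qed.

(** The bicommutant property makes [A] closed under strong limits. *)
Lemma vna_strong_limit (u : nat -> H -> H) : (forall k, A1 (u k)) ->
  (forall x, cauchy_nsq (u^~ x)) ->
  exists2 a, A1 a & forall x, tends (u^~ x) (a x).
Proof.
move=> Au cu; pose a x := sval (cid (cauchy_tends ip_norm (cu x))).
have ha x : tends (u^~ x) (a x) by rewrite /a; case: cid.
have u1 k : Asa (u k) /\ forall x, 0 <= rip (u k x) x <= nsq x.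
  exact/unit_ballP.
have ub k x : nsq (u k x) <= nsq x.
  apply: le_trans (unit_ball_nsq _ (Au k)) _.
  by have [_ /(_ x)/andP[]] := u1 k.
have cvgZ (k : R[i]) v w : tends v w ->
    tends (fun m => k *: v m) (k *: w).
  move=> hv; apply: (tends_comp ip_norm hv (f := fun x => k *: x)).
  exists (complex.Re `|k| ^+ 2) => y z.
  rewrite -scalerBr !(nsq_nrm ip_norm) -exprMn.
  rewrite -[X in X ^+ 2 <= _]/(complex.Re _) /nrm normrZ.
  rewrite -[`|k|]RRe_real ?normr_real // -[`|y - z|]RRe_real ?normr_real //.
  by rewrite -rmorphM.
have la : linear a.
  move=> k x y; apply: (tends_uniq ip_norm (ha _)).
  suff -> : u^~ (k *: x + y) = fun m => k *: u m x + u m y.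
    by apply: tendsD => //; exact: cvgZ.
  by apply/funext => m; rewrite (sa_lin (u1 m).1).
have h1 x : nsq (a x) <= nsq x by apply: tends_nsq (ha x) _ => //; exists 0%N.
have h2 x : 0 <= rip (a x) x <= nsq x.
  apply/andP; split.
    rewrite -oppr_le0 -ripNr; apply: (tends_rip ip_norm (ha x)).
    by exists 0%N => m _; rewrite ripNr oppr_le0; case/andP: ((u1 m).2 x).
  apply: (tends_rip ip_norm (ha x)).
  by exists 0%N => m _; case/andP: ((u1 m).2 x).
exists a => //; apply/unit_ballP; split=> //; apply: saI.
  apply: vnaI => //.
    apply: (@bounded_continuous _ _ ip ip_norm a 1) => // x.
    by rewrite expr1n mul1r.
  move=> s cs x; have [ls cts] := commutant_bounded cs.
  apply: (tends_uniq ip_norm (ha _)).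
  have -> : u^~ (s x) = s \o (u^~ x).
    by apply/funext => m /=; rewrite (commutantE _ cs) //; case: (Au m).
  apply: (tends_comp ip_norm (ha x)).
  have [r _ hr] := continuous_bounded ip_norm ls cts.
  by exists r => y z; rewrite -(linB ls).
suff le x y : rip (a x) y <= rip (a y) x.
  by move=> x y; rewrite (ripC ip x); apply/eqP; rewrite eq_le !le.
apply/ler_addgt0Pl => e e0; have [n hn] := tends_ripB ip_norm x (ha y) e0.
apply: (tends_rip ip_norm (ha x)); exists n => m /hn.
by rewrite (saE y x (u1 m).1) (ripC ip y) ler_norml => /andP[]; lra.
Qed.

(** An increasing sequence in the unit interval is strongly Cauchy because
    [d <= 1] gives [nsq (d x) <= rip (d x) x] for its positive increments. *)
Lemma vna_monotone_limit (u : nat -> H -> H) : (forall k, A1 (u k)) ->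
  (forall k x, rip (u k x) x <= rip (u k.+1 x) x) ->
  exists a, [/\ A1 a, forall k x, rip (u k x) x <= rip (a x) x &
    forall x r, (forall k, rip (u k x) x <= r) -> rip (a x) x <= r].
Proof.
move=> Au mono.
have u1 k : Asa (u k) /\ forall x, 0 <= rip (u k x) x <= nsq x.
  exact/unit_ballP.
have le x k m : (k <= m)%N -> rip (u k x) x <= rip (u m x) x.
  move=> /subnK <-; elim: (m - k)%N => // p IH.
  by apply: le_trans IH _; exact: mono.
have cu x : cauchy_nsq (u^~ x).
  move=> e e0; pose E := range (fun k => rip (u k x) x).
  have supE : has_sup E.
    split; first by exists (rip (u 0%N x) x), 0%N.
    by exists (nsq x) => _ [k _ <-]; case/andP: ((u1 k).2 x).
  have [_ [n _ <-] hn] := sup_adherent e0 supE.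
  exists n => k m nk km.
  have um : rip (u m x) x <= sup E by apply: ub_le_sup; [case: supE|exists m].
  have hd : A1 (u m - u k).
    apply/unit_ballP; split; first by apply: saB; [case: (u1 m)|case: (u1 k)].
    move=> z; have := le z _ _ km; rewrite !fctE ripDl ripNl.
    by case/andP: ((u1 m).2 z) => ? ?; case/andP: ((u1 k).2 z) => ? ? ?; lra.
  apply: le_lt_trans (unit_ball_nsq x hd) _; rewrite !fctE ripDl ripNl.
  by have := le x _ _ nk; lra.
have [a a1 ha] := vna_strong_limit Au cu.
exists a; split=> // [k x|x r h]; last first.
  by apply: (tends_rip ip_norm (ha x)); exists 0%N => m _; exact: h.
rewrite -lerN2 -ripNr; apply: (tends_rip ip_norm (ha x)).
by exists k => m /(le x); rewrite ripNr lerN2.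
Qed.

End Algebra.
End Algebras.

(** * Damping unbounded positive operators *)

Section Resolvent.
Context {R : realType} {H : completeNormedModType R[i]}.
Variable ip : {dot H for Num.conj}.
Hypothesis ip_norm : forall x : H, ip x x = `|x| ^+ 2.
Local Notation rip := (re_ip ip).
Local Notation nsq := (sqnorm ip).
Implicit Types (x y z : H) (r : R).

(** The iterates [F^k 0] stay within [D = d / (1 - q)] of [0], where [d] is the
    length of the first step; applying [F^m] shrinks this to [q^m D]. *)
Lemma contraction_fixpoint (F : H -> H) (q : R) : 0 <= q < 1 ->
  (forall x y, nsq (F x - F y) <= q ^+ 2 * nsq (x - y)) ->
  exists x, F x = x.
Proof.
move=> /andP[q0 q1] hF.
have Fn x y : nrm (F x - F y) <= q * nrm (x - y).
  apply: (nrm_le ip_norm); first by rewrite mulr_ge0 // nrm_ge0.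
  by rewrite exprMn -(nsq_nrm ip_norm).
pose d := nrm (F 0 - 0); pose D := d / (1 - q).
have D0 : 0 <= D by rewrite divr_ge0 ?nrm_ge0 // subr_ge0 ltW.
have Dd : q * D + d = D by rewrite /D; field; lra.
have h0 k : nrm (iter k F 0 - 0) <= D.
  elim: k => [|k IH]; first by rewrite /= subrr /nrm normr0.
  rewrite iterS -[_ - 0](subrKA (F 0)) -Dd.
  apply: le_trans (nrmD _ _) _; apply: lerD => //.
  by apply: le_trans (Fn _ _) _; exact: ler_wpM2l.
have hm m k : nrm (iter (m + k) F 0 - iter m F 0) <= q ^+ m * D.
  elim: m => [|m IH]; first by rewrite expr0 mul1r; exact: h0.
  rewrite addSn !iterS; apply: le_trans (Fn _ _) _.
  by rewrite exprS -mulrA; exact: ler_wpM2l.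
have cu : cauchy_seq ip (fun k => iter k F 0).
  move=> e e0.
  have s0 : 0 < Num.sqrt e by rewrite sqrtr_gt0.
  have : geometric D q @ \oo --> 0.
    by apply: cvg_geometric; rewrite ger0_norm.
  move/cvgrPdist_lt => /(_ _ s0)[n _ hn].
  exists n => k m nk /subnKC <-; rewrite (nsq_nrm ip_norm).
  rewrite -[ltRHS]sqr_sqrtr ?(ltW e0) // ltr_pXn2r ?nnegrE ?nrm_ge0 ?ltW //.
  apply: le_lt_trans (hm _ _) _; have := hn _ nk.
  rewrite sub0r normrN /= ger0_norm 1?mulrC // mulr_ge0 // exprn_ge0 //.
have [x hx] := cauchy_tends ip_norm cu; exists x.
apply: (tends_uniq ip_norm _ hx) => e e0.
have q2 : forall y z, nsq (F y - F z) <= 1 * nsq (y - z).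
  move=> y z; apply: le_trans (hF y z) _; apply: ler_wpM2r.
    exact: nsq_ge0.
  by rewrite expr_le1 // ltW.
have [n hn] := hx _ e0; exists n.+1 => -[//|m] nm; rewrite iterS.
by apply: le_lt_trans (q2 _ _) _; rewrite mul1r; exact: hn.
Qed.

Variable A : set (H -> H).
Hypothesis vA : von_neumann_algebra ip A.
Local Notation Asa := (selfadjoint_part ip A).
Local Notation A1 := (positive_unit_ball ip A).

(** For [X >= 0] the form of [T = X (1 + X)^-1] at [x] is the minimum over [y]
    of [nsq (x - y) + rip (X y) y]; the minimum is attained at
    [y = (1 + X)^-1 x]. This variational description makes [T] monotone in [X],
    bounded by [1] and by [X], so that sums of positive operators that are
    unbounded in norm become elements of the unit interval without any increase
    of their traces. *)
Lemma vna_damping (X : H -> H) : Asa X -> (forall x, 0 <= rip (X x) x) ->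
  exists T, [/\ A1 T,
    forall x y, rip (T x) x <= nsq (x - y) + rip (X y) y &
    forall x, exists y, rip (T x) x = nsq (x - y) + rip (X y) y].
Proof.
move=> hX X0; have [C C0 XC] := vna_sa_bounded ip_norm vA hX.
have lX := sa_lin vA hX.
have C1 : 1 + C != 0 by lra.
(* [x = (1 + X) y] is solved by iterating y |-> (x + (C - X) y) / (1 + C). *)
have ex x : exists y, y + X y = x.
  pose F y := (1 + C)^-1%:C *: (x + (C%:C *: y - X y)).
  have [y hy] : exists y, F y = y.
    apply: (@contraction_fixpoint _ (C / (1 + C))).
      by rewrite divr_ge0 ?ltr_pdivrMr /=; lra.
    move=> y z; have -> : F y - F z = (1 + C)^-1%:C *:
        (C%:C *: id (y - z) - X (y - z)).
      rewrite -scalerBr; congr (_ *: _); rewrite (linB lX) scalerBr /=.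
      by rewrite opprD addrACA subrr add0r !opprB addrACA [X in _ + X]addrC
        addrACA.
    have -> : (C / (1 + C)) ^+ 2 * nsq (y - z) =
        (1 + C)^-1 ^+ 2 * (C ^+ 2 * nsq (y - z)) by field.
    rewrite nsqZ; apply: ler_wpM2l; first exact: sqr_ge0.
    have hY : Asa (C%:C *: id - X) by apply: saB => //; apply: saZ => //; exact: sa_id.
    have Yb w : 0 <= rip ((C%:C *: id - X) w) w <= C * nsq w.
      rewrite !fctE ripDl ripNl ripZl; have := X0 w; have /andP[] := XC w.
      by rewrite -/(nsq w); lra.
    have := pos_nsq ip_norm (y - z) (sa_lin vA hY) (sa_adj hY) (ltW C0) Yb.
    move=> /le_trans; apply; rewrite expr2 -mulrA; apply: ler_wpM2l.
      exact: ltW.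
    by case/andP: (Yb (y - z)).
  exists y; have : (1 + C)%:C *: F y = (1 + C)%:C *: y by rewrite hy.
  rewrite /F scalerA -rmorphM mulfV // scale1r rmorphD scalerDl scale1r.
  rewrite addrA addrAC => /addIr/eqP; rewrite subr_eq => /eqP ->.
  by [].
have inj y z : y + X y = z + X z -> y = z.
  move=> e; apply/eqP; rewrite -subr_eq0; apply/eqP/(nsq0_eq0 ip_norm).
  have : (y - z) + X (y - z) = 0.
    by rewrite (linB lX) addrACA -opprD e subrr.
  move/(congr1 (fun w => rip w (y - z))); rewrite ripDl rip0l -/(nsq _).
  by have := X0 (y - z); have := nsq_ge0 ip_norm (y - z); lra.
pose J x := sval (cid (ex x)).
have hJ x : J x + X (J x) = x by rewrite /J; case: cid.
have lJ : linear J.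
  move=> k x y; apply: inj; rewrite hJ (linD lX) (linZ lX) addrACA -scalerDr.
  by rewrite !hJ.
have JX x : x - J x = X (J x) by rewrite -{1}(hJ x) addrC addKr.
have att x : rip (x - J x) x = nsq (x - J x) + rip (X (J x)) (J x).
  by rewrite -(JX x) /nsq -ripDr subrK.
have var x y : rip (x - J x) x <= nsq (x - y) + rip (X y) y.
  rewrite att (JX x); pose h := y - J x; have yE : y = h + J x by rewrite subrK.
  clearbody h.
  have -> : x - y = X (J x) - h by rewrite yE opprD addrA addrAC JX.
  rewrite yE (linD lX) ripDl !ripDr (nsqB ip (X (J x))).
  move: (J x) => u.
  have Xhu : rip (X h) u = rip (X u) h by rewrite (saE h u hX) ripC.
  by have := X0 h; have := nsq_ge0 ip_norm h; lra.
(* The bounds on [T = 1 - J]: take [y = J x] below and [y = 0] above. *)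
have T1 x : 0 <= rip (x - J x) x <= nsq x.
  apply/andP; split; last by have := var x 0; rewrite subr0 rip0r addr0.
  by rewrite att addr_ge0 // nsq_ge0.
have saT x y : rip (x - J x) y = rip x (y - J y).
  have saJ : rip (J x) y = rip x (J y).
    by rewrite -{1}(hJ y) ripDr -(saE _ _ hX) -ripDl hJ.
  by rewrite ripDl ripDr ripNl ripNr saJ.
have lT : linear (fun x => x - J x).
  by move=> k x y; rewrite lJ scalerBr opprD addrACA.
exists (fun x => x - J x); split=> //; last by move=> x; exists (J x).
apply/(unit_ballP vA); split=> //; split; last exact: rip_sa.
apply: (vnaI vA) => // [|s cs x].
  apply: (bounded_continuous ip_norm (r := 1)) => // x.
  rewrite expr1n; apply: le_trans (_ : 1 * rip (x - J x) x <= _); last first.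
    by rewrite !mul1r; case/andP: (T1 x).
  apply: (pos_nsq ip_norm x lT) => // [|y]; first exact: rip_sa.
  by rewrite mul1r.
have ls : linear s by case: cs => -[].
(* Both sides solve the equation defining [J (s x)]. *)
rewrite (linB ls); congr (_ - _); apply: inj.
by rewrite hJ -(commutantE _ cs (saA hX)) -(linD ls) hJ.
Qed.

End Resolvent.

(** * The trace *)

(** Membership of composite expressions. The head constant is matched
    syntactically because [vnaM] would also apply to a variable, seen as its own
    composite with the identity. *)
Ltac vna_mem := match goal with
  | h : ?A ?a |- ?A ?a => exact: h
  | h : selfadjoint_part _ ?A ?a |- ?A ?a => exact: (saA h)
  | h : positive_unit_ball _ ?A ?a |- ?A ?a => by case: h
  | v : von_neumann_algebra _ ?A, h : positive_unit_ball _ ?A ?a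
      |- selfadjoint_part _ ?A ?a => by have /(unit_ballP v)[] := h
  | v : von_neumann_algebra _ ?A |- ?A (ssrfun.comp _ _) =>
      apply: (vnaM v); vna_mem
  | v : von_neumann_algebra _ ?A |- ?A (@GRing.scale _ _ _ _) =>
      apply: (vnaZ v); vna_mem
  | v : von_neumann_algebra _ ?A |- ?A (GRing.opp _) =>
      apply: (vnaN v); vna_mem
  | v : von_neumann_algebra _ ?A |- ?A (GRing.add _ _) =>
      apply: (vnaD v); vna_mem
  | v : von_neumann_algebra _ ?A |- ?A id => exact: (vna_id v)
  | v : von_neumann_algebra _ ?A |- ?A GRing.zero => exact: (vna0 v)
  | |- _ => idtac
  end.

Section Trace.
Context {R : realType} {H : completeNormedModType R[i]}.
Variable ip : {dot H for Num.conj}.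
Hypothesis ip_norm : forall x : H, ip x x = `|x| ^+ 2.
Local Notation rip := (re_ip ip).
Local Notation nsq := (sqnorm ip).
Implicit Types (x y z : H) (r : R) (a b c : H -> H).

Lemma compDr c a b : linear c -> c \o (a + b) = (c \o a) + (c \o b).
Proof. by move=> lc; apply/funext => x; exact: (linD lc (a x) (b x)). Qed.

Lemma compNr c a : linear c -> c \o (- a) = - (c \o a).
Proof. by move=> lc; apply/funext => x; exact: (linN lc (a x)). Qed.

Lemma compBr c a b : linear c -> c \o (a - b) = (c \o a) - (c \o b).
Proof. by move=> lc; rewrite compDr // compNr. Qed.

Lemma compZr c (k : R[i]) a : linear c -> c \o (k *: a) = k *: (c \o a).
Proof. by move=> lc; apply/funext => x; exact: (linZ lc k (a x)). Qed.

Lemma compDl c a b : (a + b) \o c = (a \o c) + (b \o c).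
Proof. by []. Qed.

Lemma compZl c (k : R[i]) a : (k *: a) \o c = k *: (a \o c).
Proof. by []. Qed.

Lemma comp0l a : 0 \o a = 0 :> (H -> H).
Proof. by []. Qed.

Variables (M : set (H -> H)) (tau : (H -> H) -> R[i]).
Hypothesis vM : von_neumann_algebra ip M.
Hypothesis tauP : faithful_normal_tracial_state ip M tau.
Local Notation Msa := (selfadjoint_part ip M).

Let tauL (k : R[i]) a b : M a -> M b -> tau (k *: a + b) = k * tau a + tau b.
Proof. by case: tauP => -[h _ _] _ _ _; exact: h. Qed.

Definition rtrace a : R := complex.Re (tau a).
Local Notation tr := rtrace.

Lemma trD a b : M a -> M b -> tr (a + b) = tr a + tr b.
Proof. by move=> ha hb; rewrite /tr -[a]scale1r tauL // mul1r scale1r ReD. Qed.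

Lemma tr0 : tr 0 = 0.
Proof.
have := trD (vna0 vM) (vna0 vM); rewrite addr0 => h.
by apply: (addrI (tr 0)); rewrite addr0 -h.
Qed.

Lemma trZ r a : M a -> tr (r%:C *: a) = r * tr a.
Proof.
move=> ha; have t0 : tau 0 = 0.
  have := tauL 1 (vna0 vM) (vna0 vM); rewrite scaler0 addr0 mul1r => h.
  by apply: (addrI (tau 0)); rewrite addr0 -h.
by rewrite /tr -[_ *: _]addr0 tauL // ?t0 ?addr0 ?ReZ //; exact: (vna0 vM).
Qed.

Lemma trN a : M a -> tr (- a) = - tr a.
Proof.
by move=> ha; rewrite -scaleN1r -(rmorph1 (real_complex R)) -rmorphN trZ //
  mulN1r.
Qed.

Lemma trB a b : M a -> M b -> tr (a - b) = tr a - tr b.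
Proof. by move=> ha hb; rewrite trD ?trN //; exact: (vnaN vM). Qed.

Lemma tr_id : tr id = 1.
Proof. by case: tauP => -[_ _ h] _ _ _; rewrite /tr h. Qed.

Lemma trC a b : M a -> M b -> tr (a \o b) = tr (b \o a).
Proof. by case: tauP => _ h _ _ ha hb; rewrite /tr h. Qed.

Lemma tau_real a : Msa a -> (forall x, 0 <= rip (a x) x) ->
  0 <= tr a /\ tau a = (tr a)%:C.
Proof.
move=> ha h; have : 0 <= tau a.
  case: tauP => -[_ pos _] _ _ _; apply: pos; first by vna_mem.
  by apply/(op_leP (sa_adj (sa0 vM)) (sa_adj ha)) => x; rewrite rip0l.
move=> t0; split; first by move: t0; rewrite lecE => /andP[].
by rewrite /tr RRe_real // ger0_real.
Qed.

Lemma tr_ge0 a : Msa a -> (forall x, 0 <= rip (a x) x) -> 0 <= tr a.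
Proof. by move=> ha h; case: (tau_real ha h). Qed.

Lemma tr_le a b : Msa a -> Msa b ->
  (forall x, rip (a x) x <= rip (b x) x) -> tr a <= tr b.
Proof.
move=> ha hb h; rewrite -subr_ge0 -trB; try by vna_mem.
apply: tr_ge0 => [|x]; first exact: (saB vM).
by rewrite !fctE ripDl ripNl subr_ge0.
Qed.

Lemma tr_faithful a : Msa a -> (forall x, 0 <= rip (a x) x) -> tr a <= 0 ->
  a = 0.
Proof.
move=> ha h t0; have [t1 tE] := tau_real ha h.
case: tauP => _ _ faith _; apply: faith; first by vna_mem.
  by apply/(op_leP (sa_adj (sa0 vM)) (sa_adj ha)) => x; rewrite rip0l.
by rewrite tE; congr (_%:C); apply/le_anti; rewrite t0.
Qed.

(** The squared norm of the real inner product [tr (a \o b)] on the selfadjoint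
    elements. *)
Definition rtrace_sq a : R := tr (a \o a).
Local Notation trsq := rtrace_sq.

Lemma trsq_ge0 a : Msa a -> 0 <= trsq a.
Proof.
move=> ha; apply: tr_ge0 => [|x]; first exact: (sa_sqr vM).
by rewrite /= (saE _ _ ha); exact: nsq_ge0.
Qed.

Lemma trsq0_eq0 a : Msa a -> trsq a <= 0 -> a = 0.
Proof.
move=> ha t0; apply/funext => x; apply: (nsq0_eq0 ip_norm).
have h : a \o a = 0.
  apply: tr_faithful t0; first exact: (sa_sqr vM).
  by move=> y; rewrite /= (saE _ _ ha); exact: nsq_ge0.
by rewrite /nsq -(saE _ _ ha) -[a (a x)]/((a \o a) x) h rip0l.
Qed.

Lemma trsqD a b : Msa a -> Msa b ->
  trsq (a + b) = trsq a + 2 * tr (a \o b) + trsq b.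
Proof.
move=> ha hb; have Ma := saA ha; have Mb := saA hb.
have la := sa_lin vM ha; have lb := sa_lin vM hb.
rewrite /trsq compDl !compDr // !trD; try by vna_mem.
rewrite (trC Mb Ma); ring.
Qed.

End Trace.

Section Completeness.
Context {R : realType} {H : completeNormedModType R[i]}.
Variable ip : {dot H for Num.conj}.
Hypothesis ip_norm : forall x : H, ip x x = `|x| ^+ 2.
Variables (M : set (H -> H)) (tau : (H -> H) -> R[i]).
Hypothesis vM : von_neumann_algebra ip M.
Hypothesis tauP : faithful_normal_tracial_state ip M tau.
Local Notation rip := (re_ip ip).
Local Notation nsq := (sqnorm ip).
Local Notation Msa := (selfadjoint_part ip M).
Local Notation M1 := (positive_unit_ball ip M).
Local Notation tr := (rtrace tau).
Local Notation trsq := (rtrace_sq tau).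
Implicit Types (x y z : H) (r : R) (a b c : H -> H).

Lemma trsqZ r a : Msa a -> trsq (r%:C *: a) = r ^+ 2 * trsq a.
Proof.
move=> ha; rewrite /rtrace_sq compZl (compZr _ _ (sa_lin vM ha)).
by rewrite !(trZ vM tauP) ?expr2 ?mulrA //; vna_mem.
Qed.

Lemma trsqN a : Msa a -> trsq (- a) = trsq a.
Proof.
move=> ha; rewrite /rtrace_sq; congr (rtrace _ _).
by apply/funext => x; rewrite /= !fctE (linN (sa_lin vM ha)) opprK.
Qed.

Lemma trsqB a b : Msa a -> Msa b ->
  trsq (a - b) = trsq a - 2 * tr (a \o b) + trsq b.
Proof.
move=> ha hb; rewrite (trsqD vM tauP) ?trsqN //; last exact: (saN vM).
by rewrite (compNr _ (sa_lin vM ha)) (trN vM tauP) ?mulrN //; vna_mem.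
Qed.

Lemma tr_CS a b : Msa a -> Msa b -> tr (a \o b) ^+ 2 <= trsq a * trsq b.
Proof.
move=> ha hb; apply: discr_le => [|s]; first exact: (trsq_ge0 ip_norm vM tauP).
have := trsq_ge0 ip_norm vM tauP (saD vM ha (saZ vM s hb)).
rewrite (trsqD vM tauP) ?trsqZ //; last exact: (saZ vM).
by rewrite (compZr _ _ (sa_lin vM ha)) (trZ vM tauP) ?mulrA //; vna_mem.
Qed.

(** Normality of the trace, since the range of an increasing sequence is upward
    directed. *)
Lemma tr_sup (u : nat -> H -> H) a r : (forall k, Msa (u k)) -> Msa a ->
  (forall k x, 0 <= rip (u k x) x) ->
  (forall k x, rip (u k x) x <= rip (u k.+1 x) x) ->
  (forall k x, rip (u k x) x <= rip (a x) x) ->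
  (forall x s, (forall k, rip (u k x) x <= s) -> rip (a x) x <= s) ->
  (forall k, tr (u k) <= r) -> tr a <= r.
Proof.
move=> hu ha u0 mono ub lub tur.
have le x k m : (k <= m)%N -> rip (u k x) x <= rip (u m x) x.
  move=> /subnK <-; elim: (m - k)%N => // p IH.
  by apply: le_trans IH _; exact: mono.
have [_ _ _ normal] := tauP.
have Dsa : range u `<=` Msa by move=> _ [k _ <-].
have Ddir : upward_directed ip (range u).
  split; first by exists (u 0%N), 0%N.
  move=> _ _ [k _ <-] [m _ <-]; exists (u (maxn k m)); split.
  - by exists (maxn k m).
  - by apply/(op_leP (sa_adj (hu _)) (sa_adj (hu _))) => x; rewrite le // leq_maxl.
  - by apply/(op_leP (sa_adj (hu _)) (sa_adj (hu _))) => x; rewrite le // leq_maxr.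
have Dlub : op_lub ip M (range u) a.
  split=> // [_ [k _ <-]|c hc cu].
    exact/(op_leP (sa_adj (hu _)) (sa_adj ha)).
  apply/(op_leP (sa_adj ha) (sa_adj hc)) => x; apply: lub => k.
  by have /(op_leP (sa_adj (hu _)) (sa_adj hc)) := cu _ (imageP u (I : setT k)).
have [_ least] := normal _ _ Dsa Ddir Dlub.
have : tau a <= r%:C.
  apply: least => _ [_ [k _ <-] <-].
  by have [_ ->] := tau_real vM tauP (hu k) (u0 k); rewrite lecR.
by rewrite lecE => /andP[].
Qed.

Section SubAlgebra.
Variable A : set (H -> H).
Hypothesis vA : von_neumann_algebra ip A.
Hypothesis AM : A `<=` M.
Local Notation Asa := (selfadjoint_part ip A).
Local Notation A1 := (positive_unit_ball ip A).

Lemma sa_sub a : Asa a -> Msa a.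
Proof. by case=> /AM. Qed.

Lemma ball_sub a : A1 a -> M1 a.
Proof. by case=> /AM. Qed.

Lemma ball_sa a : A1 a -> Asa a.
Proof. by move=> ha; vna_mem. Qed.

Lemma ball_ge0 a x : A1 a -> 0 <= rip (a x) x.
Proof. by move=> /(unit_ballP vA)[_ /(_ x)/andP[]]. Qed.

Lemma ball_le1 a x : A1 a -> rip (a x) x <= nsq x.
Proof. by move=> /(unit_ballP vA)[_ /(_ x)/andP[]]. Qed.

(** The sum [2 d_m^2 + 4 d_(m+1)^2 + ...] with [k] terms. Its weights are the
    inverses of [1/2, 1/4, ...], whose sum is at most [1], so that by
    Cauchy-Schwarz its form dominates that of the square of
    [d_m + ... + d_(m+k-1)]. *)
Fixpoint sqsum (d : nat -> H -> H) (k m : nat) : H -> H :=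
  if k is k'.+1 then 2%:C *: (d m \o d m + sqsum d k' m.+1) else 0.

Section Squares.
Variable d : nat -> H -> H.
Hypothesis hd : forall k, Asa (d k).

Lemma sqsumE k m x :
  rip (sqsum d k.+1 m x) x = 2 * (nsq (d m x) + rip (sqsum d k m.+1 x) x).
Proof. by rewrite /= !fctE ripZl ripDl (saE _ _ (hd m)). Qed.

Lemma sqsum_sa k m : Asa (sqsum d k m).
Proof.
elim: k m => [|k IH] m; first exact: (sa0 vA).
by apply: (saZ vA); apply: (saD vA) => //; exact: (sa_sqr vA).
Qed.

Lemma sqsum_ge0 k m x : 0 <= rip (sqsum d k m x) x.
Proof.
elim: k m => [|k IH] m; first by rewrite /= rip0l.
by rewrite sqsumE mulr_ge0 // addr_ge0 // nsq_ge0.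
Qed.

Lemma sqsum_mono k m x : rip (sqsum d k m x) x <= rip (sqsum d k.+1 m x) x.
Proof.
elim: k m => [|k IH] m; first by rewrite /= rip0l -/(sqsum d 1 m) sqsum_ge0.
by rewrite (sqsumE k) (sqsumE k.+1) ler_pM2l // lerD2l IH.
Qed.

Lemma sqsum_shift k m x : rip (sqsum d k m.+1 x) x <= rip (sqsum d k.+1 m x) x.
Proof.
rewrite sqsumE; have := sqsum_ge0 k m.+1 x; have := nsq_ge0 ip_norm (d m x).
lra.
Qed.

Lemma tr_sqsum k m : (forall j, trsq (d j) <= (1 / 4) ^+ j) ->
  tr (sqsum d k m) <= 4 * (1 / 4) ^+ m.
Proof.
move=> hq; elim: k m => [|k IH] m /=.
  by rewrite (tr0 vM tauP) mulr_ge0 // exprn_ge0 //; lra.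
have Ms := saA (sa_sub (sqsum_sa k m.+1)); have Md := saA (sa_sub (hd m)).
rewrite (trZ vM tauP); last by vna_mem.
rewrite (trD tauP (vnaM vM Md Md) Ms).
have := IH m.+1; have := hq m; rewrite exprS; rewrite /rtrace_sq; lra.
Qed.

Lemma sqsum_dom (u : nat -> H) k m x : (forall j, u j.+1 - u j = d j x) ->
  nsq (u (m + k)%N - u m) <= rip (sqsum d k m x) x.
Proof.
move=> hu; elim: k m => [|k IH] m.
  by rewrite addn0 subrr /= rip0l /sqnorm rip0l.
rewrite sqsumE addnS -addSn -(subrKA (u m.+1)) hu.
apply: le_trans (nsqD_le ip_norm _ _) _; have := IH m.+1; lra.
Qed.

End Squares.
End SubAlgebra.
End Completeness.

(** * Completeness of the unit interval in the trace norm *)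

Section L2Complete.
Context {R : realType} {H : completeNormedModType R[i]}.
Variable ip : {dot H for Num.conj}.
Hypothesis ip_norm : forall x : H, ip x x = `|x| ^+ 2.
Variables (M : set (H -> H)) (tau : (H -> H) -> R[i]).
Hypothesis vM : von_neumann_algebra ip M.
Hypothesis tauP : faithful_normal_tracial_state ip M tau.
Variable A : set (H -> H).
Hypothesis vA : von_neumann_algebra ip A.
Hypothesis AM : A `<=` M.
Local Notation rip := (re_ip ip).
Local Notation nsq := (sqnorm ip).
Local Notation Msa := (selfadjoint_part ip M).
Local Notation Asa := (selfadjoint_part ip A).
Local Notation A1 := (positive_unit_ball ip A).
Local Notation tr := (rtrace tau).
Local Notation trsq := (rtrace_sq tau).
Implicit Types (x y z : H) (r : R) (a b c : H -> H).

Let q : R := 1 / 4.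

(** The sums [sqsum] dominate the squares of the tails, but their norms may grow
    with the number of terms. Their damped versions stay in the unit interval,
    increase with the number of terms and have small traces; [T_m] is their
    supremum, whose trace is controlled by normality. *)
Lemma tail_bound (u : nat -> H -> H) : (forall k, A1 (u k)) ->
  (forall k, trsq (u k.+1 - u k) <= q ^+ k) ->
  exists T : nat -> H -> H, [/\ forall m, A1 (T m),
    forall m, tr (T m) <= 4 * q ^+ m,
    forall m x, rip (T m.+1 x) x <= rip (T m x) x &
    forall m k x, nsq (u (m + k)%N x - u m x) <= 8 * rip (T m x) x].
Proof.
move=> hu hq; pose d k := u k.+1 - u k.
have hd k : Asa (d k) by apply: (saB vA); exact: (ball_sa vA).
pose X k m := sqsum d k m.
have Xsa k m : Asa (X k m) by exact: sqsum_sa.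
have X0 k m x : 0 <= rip (X k m x) x by exact: (sqsum_ge0 ip_norm hd).
have ex (km : nat * nat) := vna_damping ip_norm vA (Xsa km.1 km.2) (X0 _ _).
have [S hS] := choice ex.
have S1 k m : A1 (S (k, m)) by case: (hS (k, m)).
have Sle k m k' m' x : (forall y, rip (X k m y) y <= rip (X k' m' y) y) ->
    rip (S (k, m) x) x <= rip (S (k', m') x) x.
  move=> h; have [_ var _] := hS (k, m); have [_ _ att] := hS (k', m').
  have [y ->] := att x; apply: le_trans (var x y) _.
  by rewrite lerD2l; exact: h.
have Smono m k x : rip (S (k, m) x) x <= rip (S (k.+1, m) x) x.
  by apply: Sle => y; exact: (sqsum_mono ip_norm hd).
have ex' m := vna_monotone_limit ip_norm vA (S1^~ m) (Smono m).
have [T hT] := choice ex'.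
have T1 m : A1 (T m) by case: (hT m).
exists T; split=> // [m|m x|m k x].
- have [_ ub lub] := hT m.
  apply: (tr_sup vM tauP (u := fun k => S (k, m)) _ _ _ (Smono m) ub lub) => [k||k x|k].
  + exact: sa_sub (ball_sa vA (S1 _ _)).
  + exact: sa_sub (ball_sa vA (T1 _)).
  + exact: (ball_ge0 vA).
  + apply: le_trans (tr_sqsum vM tauP vA AM hd k m hq).
    apply: (tr_le vM tauP) => [||x].
    * exact: sa_sub (ball_sa vA (S1 _ _)).
    * exact: sa_sub (Xsa _ _).
    * have [_ /(_ x x) + _] := hS (k, m).
      by rewrite subrr /nsq rip0l add0r.
- have [_ _ lub] := hT m.+1; apply: lub => k.
  have [_ /(_ k.+1 x) ub _] := hT m; apply: le_trans ub.
  by apply: Sle => y; exact: (sqsum_shift ip_norm hd).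
- have [_ /(_ k x) ub _] := hT m.
  apply: (@le_trans _ _ (8 * rip (S (k, m) x) x)); last by rewrite ler_pM2l.
  have [_ _ /(_ x)[y ->]] := hS (k, m).
  have Au j := ball_sa vA (hu j).
  have wB : u (m + k)%N x - u m x = (u (m + k)%N (x - y) - u m (x - y)) +
      (u (m + k)%N y - u m y).
    by rewrite !(linB (sa_lin vA (Au _))) opprB addrAC !subrKA.
  have h1 j z : nsq (u j z) <= nsq z.
    by apply: le_trans (unit_ball_nsq ip_norm vA z (hu j)) _; exact: (ball_le1 vA).
  have h2 : nsq (u (m + k)%N (x - y) - u m (x - y)) <= 4 * nsq (x - y).
    apply: le_trans (nsqD_le ip_norm _ _) _; rewrite nsqN.
    by have := h1 (m + k)%N (x - y); have := h1 m (x - y); lra.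
  have h3 : nsq (u (m + k)%N y - u m y) <= rip (X k m y) y.
    exact: (sqsum_dom ip_norm hd (u := u^~ y)).
  rewrite wB; apply: le_trans (nsqD_le ip_norm _ _) _.
  have := X0 k m y; lra.
Qed.

(** The operators [T_m] of [tail_bound] decrease to [0] strongly, because their
    infimum has trace [0] and the trace is faithful. Hence the sequence is
    strongly Cauchy, and since the [T_m] also dominate the distances to its
    strong limit, it converges in the trace norm. *)
Lemma unit_ball_complete (u : nat -> H -> H) : (forall k, A1 (u k)) ->
  (forall k, trsq (u k.+1 - u k) <= q ^+ k) ->
  exists2 a, A1 a & forall k, trsq (u k - a) <= 32 * q ^+ k.
Proof.
move=> hu hq; have [T [T1 trT Tdec dom]] := tail_bound hu hq.
have q0 k : 0 <= q ^+ k by rewrite exprn_ge0 // /q; lra.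
have Au j := ball_sa vA (hu j).
pose V m : H -> H := id - T m.
have VE m x : rip (V m x) x = nsq x - rip (T m x) x.
  by rewrite /V !fctE ripDl ripNl.
have V1 m : A1 (V m).
  apply/(unit_ballP vA); split.
    by apply: (saB vA); [exact: sa_id|exact: (ball_sa vA)].
  move=> x; rewrite VE; have := ball_ge0 vA x (T1 m).
  by have := ball_le1 vA x (T1 m); lra.
have Vmono m x : rip (V m x) x <= rip (V m.+1 x) x.
  by rewrite !VE; have := Tdec m x; lra.
have [S [S1 Sub Slub]] := vna_monotone_limit ip_norm vA V1 Vmono.
have Msa_ball a : A1 a -> Msa a by move=> h; exact: sa_sub (ball_sa vA h).
have S_id : id - S = 0.
  apply: (tr_faithful vM tauP) => [|x|].
  - by apply: (saB vM); [exact: sa_id|exact: Msa_ball].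
  - by rewrite !fctE ripDl ripNl subr_ge0; exact: (ball_le1 vA).
  - apply/ler_addgt0Pl => e e0; rewrite addr0.
    have : geometric 4 q @ \oo --> 0.
      by apply: cvg_geometric; rewrite /q ger0_norm; lra.
    move/cvgrPdist_lt => /(_ _ e0)[m _ /(_ m (leqnn m))].
    rewrite sub0r normrN /= ger0_norm ?mulr_ge0 // => hm.
    apply: le_trans (ltW hm); apply: le_trans (trT m).
    apply: (tr_le vM tauP) => [||x].
    + by apply: (saB vM); [exact: sa_id|exact: Msa_ball].
    + exact: Msa_ball.
    + by rewrite !fctE ripDl ripNl -/(nsq x); have := Sub m x; rewrite VE; lra.
have Tsmall x e : 0 < e -> exists m, rip (T m x) x < e.
  move=> e0; apply/not_existsP => h.
  have : rip (S x) x <= nsq x - e.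
    apply: Slub => m; rewrite VE lerD2l lerN2 leNgt; apply/negP; exact: h.
  have -> : S x = x.
    by have := congr1 (@^~ x) S_id => /= /eqP; rewrite subr_eq0 => /eqP.
  by rewrite -/(nsq x); lra.
have cu x : cauchy_seq ip (u^~ x).
  move=> e e0; have e32 : 0 < e / 64 by lra.
  have [m hm] := Tsmall x _ e32; exists m => k l mk kl.
  have -> : u l x - u k x = (u l x - u m x) + - (u k x - u m x).
    by rewrite opprB addrA subrK.
  apply: le_lt_trans (nsqD_le ip_norm _ _) _; rewrite nsqN.
  have := dom m (k - m)%N x; have := dom m (l - m)%N x.
  rewrite !subnKC ?(leq_trans mk kl) //; lra.
have [a a1 ha] := vna_strong_limit ip_norm vA hu cu.
exists a => // m; have Aa := ball_sa vA a1.
have hd : Msa (u m - a) by apply: (saB vM); exact: Msa_ball.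
have -> : 32 * q ^+ m = 8 * (4 * q ^+ m) by lra.
apply: (@le_trans _ _ (8 * tr (T m))); last by rewrite ler_pM2l.
rewrite -(trZ vM tauP); last by case: (Msa_ball _ (T1 m)).
apply: (tr_le vM tauP) => [||x].
- exact: (sa_sqr vM).
- by apply: (saZ vM); exact: Msa_ball.
- rewrite [leLHS](saE _ _ hd) -/(nsq _) !fctE ripZl -nsqN opprB.
  have hs : tendsto ip (fun k => u k x - u m x) (a x - u m x).
    move=> e e0; have [n hn] := ha x e e0; exists n => k /hn.
    by rewrite opprB addrA subrK.
  apply: (tends_nsq ip_norm hs); exists m => k mk.
  by have := dom m (k - m)%N x; rewrite subnKC.
Qed.

End L2Complete.

(** * The spectral scale is a compact convex set *)

Lemma le0_geometric (R : realType) (K z : R) :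
  (forall k, z <= K * (1 / 4) ^+ k) -> z <= 0.
Proof.
move=> h; apply/ler_addgt0Pl => e e0; rewrite addr0.
have : geometric K (1 / 4) @ \oo --> (0 : R).
  by apply: cvg_geometric; rewrite ger0_norm; lra.
move/cvgrPdist_lt => /(_ _ e0)[m _ /(_ m (leqnn m))].
rewrite sub0r normrN /= => hm.
by apply: le_trans (ltW hm); apply: le_trans (h m) _; exact: ler_norm.
Qed.

Lemma rV_norm_le (R : realType) n (v : 'rV[R]_n) (e : R) : 0 <= e ->
  (forall j, `|v 0 j| <= e) -> `|v| <= e.
Proof.
move=> e0 h; rewrite /Num.norm /= mx_normrE; apply/bigmax_leP; split=> //= -[i j] _.
by rewrite (ord1 i).
Qed.

Lemma rV_combE (R : realType) n (r s : R) (v w : 'rV[R]_n) j :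
  (r *: v + s *: w) 0 j = r * v 0 j + s * w 0 j.
Proof. by rewrite !mxE. Qed.

Lemma rV_addE (R : realType) n (v w : 'rV[R]_n) j :
  (v + w) 0 j = v 0 j + w 0 j.
Proof. by rewrite !mxE. Qed.

Lemma rV_subE (R : realType) n (v w : 'rV[R]_n) j :
  (v - w) 0 j = v 0 j - w 0 j.
Proof. by rewrite !mxE. Qed.

Section SpectralScale.
Context {R : realType} {H : completeNormedModType R[i]}.
Variable ip : {dot H for Num.conj}.
Hypothesis ip_norm : forall x : H, ip x x = `|x| ^+ 2.
Variables (M : set (H -> H)) (tau : (H -> H) -> R[i]).
Hypothesis vM : von_neumann_algebra ip M.
Hypothesis tauP : faithful_normal_tracial_state ip M tau.
Variables (n : nat) (b : 'I_n -> H -> H).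
Local Notation nsq := (sqnorm ip).
Local Notation Msa := (selfadjoint_part ip M).
Local Notation tr := (rtrace tau).
Local Notation trsq := (rtrace_sq tau).
Implicit Types (x : H) (y z : 'rV[R]_n.+1) (r : R) (a c : H -> H).
Hypothesis bM : forall i, Msa (b i).

(** With the unit as zeroth coefficient, the trace coordinate of the spectral
    map needs no separate treatment. *)
Definition coefs (j : 'I_n.+1) : H -> H :=
  if unlift ord0 j is Some i then b i else id.
Local Notation coef := coefs.

Lemma spectral_mapE a j : spectral_map tau b a 0 j = tr (coef j \o a).
Proof. by rewrite mxE /coef; case: unlift. Qed.

Lemma coef_sa j : Msa (coef j).
Proof. by rewrite /coef; case: unlift => [i|]; [exact: bM|exact: (sa_id vM)]. Qed.

Lemma coef0 : coef ord0 = id.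
Proof. by rewrite /coef unlift_none. Qed.

Local Notation Psi := (spectral_map tau b).

Lemma Psi_D a c : M a -> M c -> Psi (a + c) = Psi a + Psi c.
Proof.
move=> ha hc; apply/rowP => j; rewrite [RHS]mxE !spectral_mapE.
have cM := saA (coef_sa j).
by rewrite (compDr _ _ (vna_lin vM cM)) (trD tauP) //; vna_mem.
Qed.

Lemma Psi_Z r a : M a -> Psi (r%:C *: a) = r *: Psi a.
Proof.
move=> ha; apply/rowP => j; rewrite [RHS]mxE !spectral_mapE.
have cM := saA (coef_sa j).
by rewrite (compZr _ _ (vna_lin vM cM)) (trZ vM tauP) //; vna_mem.
Qed.

Lemma Psi_B a c : M a -> M c -> Psi (a - c) = Psi a - Psi c.
Proof.
move=> ha hc; rewrite Psi_D //; last by vna_mem.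
have -> : - c = (-1)%:C *: c by rewrite rmorphN rmorph1 scaleN1r.
by rewrite Psi_Z // scaleN1r.
Qed.

Lemma Psi_tr a : tr a = Psi a 0 ord0.
Proof. by rewrite spectral_mapE coef0. Qed.

Section SubAlgebra.
Variable A : set (H -> H).
Hypothesis vA : von_neumann_algebra ip A.
Hypothesis AM : A `<=` M.
Local Notation A1 := (positive_unit_ball ip A).
Local Notation BA := (spectral_scale ip A tau b).

Lemma ball_convex r a c : 0 <= r <= 1 -> A1 a -> A1 c ->
  A1 (r%:C *: a + (1 - r)%:C *: c).
Proof.
move=> /andP[r0 r1] ha hc; apply/(unit_ballP vA); split.
  by apply: (saD vA); apply: (saZ vA); exact: (ball_sa vA).
move=> x; rewrite !fctE ripDl !ripZl.
have a0 := ball_ge0 vA x ha; have c0 := ball_ge0 vA x hc.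
have a1 := ball_le1 vA x ha; have c1 := ball_le1 vA x hc.
have r1' : 0 <= 1 - r by lra.
have -> : nsq x = r * nsq x + (1 - r) * nsq x by ring.
by rewrite addr_ge0 ?mulr_ge0 //= lerD // ler_wpM2l.
Qed.

Lemma ballM a : A1 a -> M a.
Proof. by case=> /AM. Qed.

Lemma scale_convex r y z : 0 <= r <= 1 -> BA y -> BA z ->
  BA (r *: y + (1 - r) *: z).
Proof.
move=> hr [a ha <-] [c hc <-]; exists (r%:C *: a + (1 - r)%:C *: c).
  exact: ball_convex.
by rewrite Psi_D ?Psi_Z //; try (apply: (vnaZ vM)); exact: ballM.
Qed.

Lemma ball_trsq a : A1 a -> trsq a <= 1.
Proof.
move=> ha; rewrite -(tr_id tauP); apply: (tr_le vM tauP) => [||x].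
- by apply: (sa_sqr vM); exact: sa_sub (ball_sa vA ha).
- exact: sa_id.
- rewrite /= (saE _ _ (ball_sa vA ha)).
  by apply: le_trans (unit_ball_nsq ip_norm vA x ha) (ball_le1 vA x ha).
Qed.

Lemma Psi_CS a j : Msa a -> (Psi a 0 j) ^+ 2 <= trsq (coef j) * trsq a.
Proof.
by move=> ha; rewrite spectral_mapE; exact: (tr_CS ip_norm vM tauP (coef_sa j)).
Qed.

Lemma scale_bounded : exists2 K, 0 < K & forall y j, BA y -> `|y 0 j| <= K.
Proof.
have t0 j : 0 <= trsq (coef j) by exact: (trsq_ge0 ip_norm vM tauP (coef_sa j)).
exists (1 + \sum_j trsq (coef j)).
  by rewrite ltr_wpDr // sumr_ge0.
move=> _ j [a ha <-].
have S0 : trsq (coef j) <= \sum_j trsq (coef j).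
  by rewrite (bigD1 j) //= lerDl sumr_ge0.
have h : (Psi a 0 j) ^+ 2 <= trsq (coef j).
  apply: le_trans (Psi_CS j (sa_sub AM (ball_sa vA ha))) _.
  by rewrite -[leRHS]mulr1 ler_wpM2l // ball_trsq.
rewrite -ler_sqr ?nnegrE // ?addr_ge0 ?sumr_ge0 // real_normK ?num_real //.
apply: le_trans h _; apply: le_trans S0 _; set S := \sum_j _.
have Sge0 : 0 <= S by rewrite /S sumr_ge0.
nra.
Qed.

End SubAlgebra.
End SpectralScale.

Section Geometry.
Context {R : realType} {H : completeNormedModType R[i]}.
Variable ip : {dot H for Num.conj}.
Hypothesis ip_norm : forall x : H, ip x x = `|x| ^+ 2.
Variables (M : set (H -> H)) (tau : (H -> H) -> R[i]).
Hypothesis vM : von_neumann_algebra ip M.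
Hypothesis tauP : faithful_normal_tracial_state ip M tau.
Variables (n : nat) (b : 'I_n -> H -> H).
Local Notation Msa := (selfadjoint_part ip M).
Local Notation tr := (rtrace tau).
Local Notation trsq := (rtrace_sq tau).
Hypothesis bM : forall i, Msa (b i).
Local Notation coef := (coefs b).
Local Notation Psi := (spectral_map tau b).
Variable A : set (H -> H).
Hypothesis vA : von_neumann_algebra ip A.
Hypothesis AM : A `<=` M.
Local Notation A1 := (positive_unit_ball ip A).
Local Notation BA := (spectral_scale ip A tau b).
Implicit Types (x : H) (y z : 'rV[R]_n.+1) (r : R) (a c : H -> H).

Let A1Msa a : A1 a -> Msa a.
Proof. by move=> h; apply: (sa_sub AM); exact: (ball_sa vA). Qed.
Let A1M a : A1 a -> M a. Proof. by move=> /A1Msa; exact: saA. Qed.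

(** The parallelogram law, with the weights in the form used by
    [ball_convex]. *)
Lemma trsq_mid a c : Msa a -> Msa c ->
  trsq ((1 / 2)%:C *: a + (1 - 1 / 2)%:C *: c) =
  trsq a / 2 + trsq c / 2 - trsq (a - c) / 4.
Proof.
move=> ha hc; have -> : 1 - 1 / 2 = 1 / 2 :> R by lra.
rewrite (trsqD vM tauP (saZ vM _ ha) (saZ vM _ hc)) (trsqB vM tauP ha hc).
rewrite (trsqZ vM tauP _ ha) (trsqZ vM tauP _ hc).
rewrite compZl (compZr _ _ (sa_lin vM ha)) !(trZ vM tauP); try by vna_mem.
by field.
Qed.

(** Elements [a] of the unit interval with [Psi a] close to a point [y] of the
    closure and with [tr (a^2)] close to minimal form a Cauchy sequence, by the
    parallelogram law; this replaces weak compactness of the unit interval. *)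
Lemma scale_closed : closed BA.
Proof.
move=> y cy.
pose C (e : R) := [set a | A1 a /\ forall j, `|Psi a 0 j - y 0 j| < e].
have C0 e : 0 < e -> trsq @` C e !=set0.
  move=> e0; have [_ [[a ha <-] [_ hb]]] := cy _ (nbhsx_ballx y e e0).
  exists (trsq a), a => //; split=> // j; rewrite distrC; exact: hb.
have Clb e : has_lbound (trsq @` C e).
  by exists 0 => _ [a [ha _] <-]; exact: (trsq_ge0 ip_norm vM tauP (A1Msa ha)).
pose mu e := inf (trsq @` C e).
have mu_le e a : C e a -> mu e <= trsq a.
  by move=> ha; apply: ge_inf => //; exists a.
have mu_mono e e' : 0 < e -> e <= e' -> mu e' <= mu e.
  move=> e0 ee'; apply: lb_le_inf; first exact: C0.
  move=> _ [a [ha h] <-]; apply: mu_le; split=> // j.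
  exact: lt_le_trans (h j) ee'.
have mu1 e : 0 < e -> mu e <= 1.
  move=> /C0[_ [a ha _]]; apply: le_trans (mu_le _ _ ha) _.
  by apply: (ball_trsq ip_norm vM tauP vA AM); case: ha.
pose E := mu @` [set e | 0 < e]; pose nu := sup E.
have supE : has_sup E.
  by split; [exists (mu 1), 1 => //=|exists 1 => _ [e e0 <-]; exact: mu1].
have near_min (eta : R) : 0 < eta -> exists ea : R * (H -> H),
    [/\ 0 < ea.1 <= eta, C ea.1 ea.2, nu - eta < mu ea.1 &
      trsq ea.2 < nu + eta].
  move=> eta0; have [_ [e0 /= e0_gt0 <-] he0] := sup_adherent eta0 supE.
  pose e := Num.min e0 eta; have e_gt0 : 0 < e by rewrite lt_min e0_gt0.
  have [_ [a ha <-] hlt] := inf_adherent eta0 (conj (C0 e e_gt0) (Clb e)).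
  exists (e, a); split=> //=.
  - by rewrite e_gt0 ge_min lexx orbT.
  - by apply: lt_le_trans he0 _; apply: mu_mono => //; rewrite ge_min lexx.
  - apply: lt_le_trans hlt _; rewrite lerD2r.
    by apply: ub_le_sup; [case: supE|exists e].
pose eta k : R := 1 / 8 * (1 / 4) ^+ k.
have q0 k : 0 < (1 / 4 : R) ^+ k by rewrite exprn_gt0 //; lra.
have eta0 k : 0 < eta k by rewrite /eta mulr_gt0 //; lra.
have [ea hea] := choice (fun k => near_min _ (eta0 k)).
pose u k := (ea k).2.
have hu k : A1 (u k) by have [_ [] ] := hea k.
have Mu k : M (u k) by exact: A1M (hu k).
have cauchy k : trsq (u k.+1 - u k) <= (1 / 4) ^+ k.
  have [/andP[e0 e1] [_ c1] m1 t1] := hea k.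
  have [/andP[e0' e1'] [_ c2] m2 t2] := hea k.+1.
  have etaS : eta k.+1 <= eta k.
    by rewrite /eta exprS; have := q0 k; lra.
  pose e := Num.max (ea k).1 (ea k.+1).1.
  have eE : e = (ea k).1 \/ e = (ea k.+1).1.
    by rewrite /e; case: leP => _; [right|left].
  have mue : nu - eta k < mu e.
    by case: eE => -> //; apply: le_lt_trans m2; rewrite lerD2l lerN2.
  have mid : C e ((1 / 2)%:C *: u k.+1 + (1 - 1 / 2)%:C *: u k).
    split; first by apply: (ball_convex vA) => //; lra.
    move=> j; rewrite (Psi_D vM tauP bM (vnaZ vM _ (Mu _)) (vnaZ vM _ (Mu _))).
    rewrite !(Psi_Z vM tauP bM _ (Mu _)).
    have h1 : `|Psi (u k) 0 j - y 0 j| < e.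
      by apply: lt_le_trans (c1 j) _; rewrite le_max lexx.
    have h2 : `|Psi (u k.+1) 0 j - y 0 j| < e.
      by apply: lt_le_trans (c2 j) _; rewrite le_max lexx orbT.
    rewrite rV_combE; move: h1 h2; rewrite !ltr_norml.
    by move=> /andP[? ?] /andP[? ?]; apply/andP; split; lra.
  have := mu_le _ _ mid; rewrite trsq_mid; [|exact: A1Msa..].
  have -> : (1 / 4 : R) ^+ k = 8 * eta k by rewrite /eta; lra.
  rewrite -/(u k) -/(u k.+1) in t1 t2 *; lra.
have [a a1 ha] := unit_ball_complete ip_norm vM tauP vA AM hu cauchy.
exists a => //; apply/rowP => j.
apply/eqP; rewrite -subr_eq0 -sqrf_eq0 eq_le sqr_ge0 andbT.
pose K := trsq (coef j) * 64 + 2.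
apply: (@le0_geometric _ K) => k.
have [/andP[e0 e1] [_ c1] _ _] := hea k.
have := Psi_CS ip_norm vM tauP bM j (saB vM (A1Msa (hu k)) (A1Msa a1)).
rewrite (Psi_B vM tauP bM (Mu k) (A1M a1)).
rewrite rV_subE => h1.
have h2 : (Psi (u k) 0 j - y 0 j) ^+ 2 <= (1 / 4) ^+ k.
  have := lt_le_trans (c1 j) e1; rewrite ltr_norml -/(u k) => /andP[].
  have := eta0 k; have qk := q0 k.
  have : (1 / 4 : R) ^+ k <= 1 by apply: exprn_ile1; lra.
  rewrite /eta; nra.
have h3 : trsq (coef j) * trsq (u k - a) <= trsq (coef j) * (32 * (1 / 4) ^+ k).
  apply: ler_wpM2l (ha k).
  exact: (trsq_ge0 ip_norm vM tauP (coef_sa vM bM j)).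
have h4 := sqr_ge0 (Psi (u k) 0 j - y 0 j + (Psi (u k) 0 j - Psi a 0 j)).
move: h1 h2 h3 h4; rewrite /K.
move: (Psi (u k) 0 j) (Psi a 0 j) (y 0 j) => p1 p2 p3.
move: (trsq (coef j)) (trsq (u k - a)) ((1 / 4) ^+ k) => T t Q h1 h2 h3 h4.
have -> : (p2 - p3) ^+ 2 = 2 * (p1 - p2) ^+ 2 + 2 * (p1 - p3) ^+ 2 -
    (p1 - p3 + (p1 - p2)) ^+ 2 by ring.
have -> : (T * 64 + 2) * Q = 2 * (T * (32 * Q)) + 2 * Q by ring.
lra.
Qed.

Lemma scale_compact : compact BA.
Proof.
apply: bounded_closed_compact scale_closed.
have [K K0 hK] := scale_bounded ip_norm vM tauP bM vA AM.
exists K; split; first exact: num_real.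
move=> L KL y By; apply: rV_norm_le => [|j]; first by apply: ltW; apply: lt_trans KL.
by apply: le_trans (hK _ j By) _; exact: ltW.
Qed.

End Geometry.

(** * Extreme points and maximizers *)

Section Extremal.
Context {R : realType} {H : completeNormedModType R[i]}.
Variable ip : {dot H for Num.conj}.
Hypothesis ip_norm : forall x : H, ip x x = `|x| ^+ 2.
Variables (M : set (H -> H)) (tau : (H -> H) -> R[i]).
Hypothesis vM : von_neumann_algebra ip M.
Hypothesis tauP : faithful_normal_tracial_state ip M tau.
Variables (n : nat) (b : 'I_n -> H -> H).
Local Notation rip := (re_ip ip).
Local Notation nsq := (sqnorm ip).
Local Notation Msa := (selfadjoint_part ip M).
Local Notation tr := (rtrace tau).
Hypothesis bM : forall i, Msa (b i).
Local Notation Psi := (spectral_map tau b).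
Variable A : set (H -> H).
Hypothesis vA : von_neumann_algebra ip A.
Hypothesis AM : A `<=` M.
Local Notation Asa := (selfadjoint_part ip A).
Local Notation A1 := (positive_unit_ball ip A).
Local Notation BA := (spectral_scale ip A tau b).
Implicit Types (x : H) (y z : 'rV[R]_n.+1) (r s : R) (a c : H -> H).

Let A1sa a : A1 a -> Asa a. Proof. exact: (ball_sa vA). Qed.
Let A1Msa a : A1 a -> Msa a.
Proof. by move=> h; apply: (sa_sub AM); exact: (ball_sa vA). Qed.
Let A1M a : A1 a -> M a. Proof. by move=> /A1Msa; exact: saA. Qed.

Lemma sqr_rip a x : Asa a -> rip ((a \o a) x) x = nsq (a x).
Proof. by move=> ha; rewrite /= (saE _ _ ha). Qed.

Lemma ball_sqr a : A1 a -> A1 (a \o a).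
Proof.
move=> ha; apply/(unit_ballP vA); split; first by apply: (sa_sqr vA); exact: A1sa.
move=> x; rewrite sqr_rip ?nsq_ge0 //=; last exact: A1sa.
by apply: le_trans (unit_ball_nsq ip_norm vA x ha) _; exact: (ball_le1 vA).
Qed.

(** [2 a - a^2 = 1 - (1 - a)^2]. *)
Lemma ball_2B_sqr a : A1 a -> A1 (a + (a - (a \o a))).
Proof.
move=> ha; have sa := A1sa ha; apply/(unit_ballP vA); split.
  by apply: (saD vA) => //; apply: (saB vA) => //; exact: (sa_sqr vA).
move=> x; rewrite !fctE !ripDl ripNl sqr_rip //.
have := unit_ball_nsq ip_norm vA x ha; have := ball_ge0 vA x ha.
have := nsq_ge0 ip_norm (x - a x); rewrite nsqB (ripC ip x).
by move=> ? ? ?; apply/andP; split; lra.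
Qed.

(** [Psi a] is the midpoint of the images of [a^2] and [2 a - a^2], which
    therefore coincide; the trace coordinate gives [tr (a - a^2) = 0]. *)
Lemma extreme_idem a : A1 a -> extreme_points BA (Psi a) -> a \o a = a.
Proof.
move=> ha [_ ext]; have sa := A1sa ha; have Ma := A1M ha.
have Ma2 : M (a \o a) by vna_mem.
have half : 0 < (1 / 2 : R) < 1 by apply/andP; split; lra.
have [] := ext (Psi (a \o a)) (Psi (a + (a - (a \o a)))) (1 / 2).
- by exists (a \o a) => //; exact: ball_sqr.
- by exists (a + (a - (a \o a))) => //; exact: ball_2B_sqr.
- exact: half.
- rewrite (Psi_D vM tauP bM Ma (vnaB vM Ma Ma2)) (Psi_B vM tauP bM Ma Ma2).
  by apply/rowP => j; rewrite rV_combE rV_addE rV_subE; lra.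
move=> /(congr1 (fun v : 'rV_n.+1 => v 0 ord0)); rewrite -!(Psi_tr tau b) => h _.
apply/esym/eqP; rewrite -subr_eq0; apply/eqP.
apply: (tr_faithful vM tauP) => [|x|].
- by apply: (saB vM); [exact: A1Msa|apply: (sa_sqr vM); exact: A1Msa].
- rewrite !fctE ripDl ripNl sqr_rip // subr_ge0.
  exact: (unit_ball_nsq ip_norm vA).
- by rewrite (trB vM tauP) // h subrr.
Qed.

(** First variation of [tr (c a)] at [a] along [(1 + s k) a (1 - s k)], where
    [k = a c - c a] is skew: the derivative at [s = 0] is [tr (k^2)], and
    dividing by the bound [1 + s^2 K] of the norm only matters at order 2. *)
Lemma maximizer_commutes a c : A1 a -> Asa c ->
  (forall d, A1 d -> tr (c \o d) <= tr (c \o a)) -> a \o c = c \o a.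
Proof.
move=> ha hc hmax; have sa := A1sa ha.
have la := sa_lin vA sa; have lc := sa_lin vA hc.
have Ma := A1M ha; have Mc : M c := AM (saA hc).
pose k := (a \o c) - (c \o a).
have Ak : A k by apply: (vnaB vA); vna_mem.
have Mk := AM Ak; have lk := vna_lin vA Ak.
have kN x x' : rip (k x) x' = - rip x (k x').
  rewrite /k !fctE /= ripDl ripDr ripNl ripNr.
  by rewrite (saE _ _ sa) (saE _ _ hc) (saE _ _ hc) (saE _ _ sa); ring.
have kE : k = (a \o c) - (c \o a) by [].
clearbody k.
have kx x : rip (k x) x = 0 by have := kN x x; rewrite (ripC ip x); lra.
have [K K0 hK] := continuous_bounded ip_norm lk (vna_continuous vA Ak).
pose w s := (id + s%:C *: k) \o a \o (id - s%:C *: k).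
have Aw s : A (w s) by rewrite /w; vna_mem.
have wE s x : w s x = a (x - s%:C *: k x) + s%:C *: k (a (x - s%:C *: k x)).
  by [].
have wq s x x' : rip (w s x) x' = rip (a (x - s%:C *: k x)) (x' - s%:C *: k x').
  by rewrite wE ripDl ripZl kN ripDr ripNr ripZr mulrN.
have wsa s : Asa (w s).
  apply: (saI vA) => // x x'; rewrite wq (saE _ _ sa) (ripC ip _ (a _)) -wq.
  exact: ripC.
have den s : 0 < 1 + s ^+ 2 * K by rewrite ltr_wpDr // mulr_ge0 // sqr_ge0.
have w1 s : A1 ((1 + s ^+ 2 * K)^-1%:C *: w s).
  apply/(unit_ballP vA); split; first exact: (saZ vA).
  move=> x; rewrite !fctE ripZl wq; set x' := x - _.
  have a0 := ball_ge0 vA x' ha; have a1 := ball_le1 vA x' ha.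
  rewrite mulr_ge0 ?invr_ge0 ?(ltW (den s)) //= ler_pdivrMl //.
  apply: le_trans a1 _; rewrite /x' nsqB ripZr (ripC ip x) kx nsqZ.
  have := ler_wpM2l (sqr_ge0 s) (hK x); lra.
pose E := tr (c \o (k \o (a \o k))); pose D := tr (k \o k).
have DE : tr (c \o (k \o a)) - tr (c \o (a \o k)) = D.
  rewrite (trC tauP Mc (vnaM vM Mk Ma)).
  rewrite -[c \o (a \o k)]/((c \o a) \o k) (trC tauP (vnaM vM Mc Ma) Mk).
  by rewrite /D {4}kE (compBr _ _ lk) (trB vM tauP) //; vna_mem.
have trw s : tr (c \o w s) = tr (c \o a) + s * D - s ^+ 2 * E.
  have -> : w s = a + s%:C *: ((k \o a) - (a \o k)) -
      (s ^+ 2)%:C *: (k \o (a \o k)).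
    apply/funext => x; rewrite wE (linB la) (linZ la) (linB lk) (linZ lk).
    rewrite scalerBr scalerA -rmorphM -expr2 !fctE /= scalerBr !addrA.
    by congr (_ - _); rewrite addrAC.
  rewrite (compBr _ _ lc) (compDr _ _ lc) !(compZr _ _ lc) (compBr _ _ lc).
  rewrite (trB vM tauP) ?(trD tauP) ?(trZ vM tauP) ?(trB vM tauP) ?DE //;
    by vna_mem.
have Dle s : 0 <= 0 + 2 * s * (- D / 2) + s ^+ 2 * `|K * tr (c \o a) + E|.
  have := hmax _ (w1 s); rewrite (compZr _ _ lc) (trZ vM tauP); last first.
    by have Mw := AM (Aw s); vna_mem.
  rewrite ler_pdivrMl // trw => h.
  have := ler_wpM2l (sqr_ge0 s) (ler_norm (K * tr (c \o a) + E)); lra.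
have D0 : D = 0.
  have := discr_le (normr_ge0 _) Dle; rewrite mul0r => h.
  apply/eqP; rewrite -sqrf_eq0 eq_le sqr_ge0 andbT.
  by move: h; rewrite expr_div_n sqrrN; lra.
have kk : - (k \o k) = 0.
  apply: (tr_faithful vM tauP) => [|x|].
  - by apply: (saI vM) => [|x x']; [vna_mem|rewrite !fctE /= ripNl ripNr !kN opprK].
  - by rewrite !fctE /= ripNl kN opprK; exact: nsq_ge0.
  - by rewrite (trN vM tauP) -/D ?D0 ?oppr0 //; vna_mem.
apply/funext => x; apply/eqP; rewrite -subr_eq0; apply/eqP.
have -> : (a \o c) x - (c \o a) x = k x by rewrite kE.
apply: (nsq0_eq0 ip_norm).
have /(congr1 (@^~ x)) kkx := kk.
by rewrite /sqnorm -[LHS]opprK -kN -ripNl -[- k (k x)]/((- (k \o k)) x) kkx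
  rip0l.
Qed.

End Extremal.

(** * Positivity tested on a subalgebra *)

(** A convex sequence that increases once grows at least linearly. *)
Lemma convex_seq_bounded (R : realType) (s : nat -> R) (K : R) :
  (forall m, 2 * s m.+1 <= s m + s m.+2) -> (forall m, s m <= K) ->
  s 1%N <= s 0%N.
Proof.
move=> cvx bnd; rewrite leNgt; apply/negP => lt.
pose d := s 1%N - s 0%N; have d0 : 0 < d by rewrite subr_gt0.
have inc m : d <= s m.+1 - s m.
  elim: m => [|m IH]; first exact: lexx.
  by have := cvx m; lra.
have lin m : s 0%N + m%:R * d <= s m.
  elim: m => [|m IH]; first by rewrite mul0r addr0.
  by rewrite -natr1 mulrDl mul1r; have := inc m; lra.
have /archi_boundP : 0 <= `|K - s 0%N| / d by rewrite divr_ge0 // ltW.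
set m := Num.bound _; rewrite ltr_pdivrMr // => hm.
by have := ler_norm (K - s 0%N); have := lin m; have := bnd m; lra.
Qed.

Section Positivity.
Context {R : realType} {H : completeNormedModType R[i]}.
Variable ip : {dot H for Num.conj}.
Hypothesis ip_norm : forall x : H, ip x x = `|x| ^+ 2.
Variables (M : set (H -> H)) (tau : (H -> H) -> R[i]).
Hypothesis vM : von_neumann_algebra ip M.
Hypothesis tauP : faithful_normal_tracial_state ip M tau.
Local Notation rip := (re_ip ip).
Local Notation nsq := (sqnorm ip).
Local Notation Msa := (selfadjoint_part ip M).
Local Notation M1 := (positive_unit_ball ip M).
Local Notation tr := (rtrace tau).
Variable A : set (H -> H).
Hypothesis vA : von_neumann_algebra ip A.
Hypothesis AM : A `<=` M.
Local Notation Asa := (selfadjoint_part ip A).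
Local Notation A1 := (positive_unit_ball ip A).
Implicit Types (x : H) (r s : R) (a c : H -> H).

Lemma iter_sa v k : Asa v -> Asa (iter k v).
Proof.
move=> hv; elim: k => [|k IH]; first exact: (sa_id vA).
apply: (saI vA) => [|x x']; first exact: (vnaM vA (saA hv) (saA IH)).
by rewrite /= (saE _ _ hv) (saE _ _ IH) -iterSr.
Qed.

Lemma iter_bound v k : Asa v -> (forall x, 0 <= rip (v x) x <= 2 * nsq x) ->
  forall x, 0 <= rip (iter k v x) x <= 2 ^+ k * nsq x.
Proof.
move=> hv v2; elim/ltn_ind: k => -[|[|k]] IH x.
- by rewrite expr0 mul1r nsq_ge0 //= /nsq lexx.
- by rewrite expr1; exact: v2.
- have /andP[i0 i1] := IH k (leqnSn _) (v x).
  have -> : rip (iter k.+2 v x) x = rip (iter k v (v x)) (v x).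
    by rewrite iterS iterSr (saE _ _ hv).
  rewrite i0 /=; apply: le_trans i1 _.
  have := pos_nsq ip_norm x (sa_lin vA hv) (sa_adj hv) (ler0n R 2) v2 => h.
  have /andP[_ h'] := v2 x.
  rewrite !exprSr -!mulrA; apply: ler_wpM2l; first exact: exprn_ge0.
  by apply: le_trans h _; exact: ler_wpM2l.
Qed.

(** The trace of [w] against the unit interval of [M] is controlled by the
    subalgebra containing [w]: the powers of [v = 1 - w] have bounded trace
    when [tr (w v^k) >= 0], hence the convex sequence [tr (v^m a v^m)] is
    bounded and cannot increase. Its first step [tr (v^2 a) <= tr a] reads
    [tr (w a w) <= 2 tr (w a)], and [w a w] is positive. *)
Lemma subalgebra_positive w a : Asa w ->
  (forall x, - nsq x <= rip (w x) x <= nsq x) ->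
  (forall y, A1 y -> 0 <= tr (w \o y)) -> M1 a -> 0 <= tr (w \o a).
Proof.
move=> hw wb wpos ha; have lw := sa_lin vA hw.
pose v : H -> H := id - w.
have hv : Asa v by apply: (saB vA) => //; exact: sa_id.
have v2 x : 0 <= rip (v x) x <= 2 * nsq x.
  rewrite /v !fctE ripDl ripNl -/(nsq x).
  by have /andP[? ?] := wb x; apply/andP; split; lra.
have hP k : Asa (iter k v) by exact: iter_sa.
have Pb k := iter_bound k hv v2.
have Mw := AM (saA hw); have Ma : M a by case: ha.
have MP k : M (iter k v) := AM (saA (hP k)).
have Pdec k : tr (iter k.+1 v) <= tr (iter k v).
  have p2 : 0 < (2 : R) ^+ k by rewrite exprn_gt0.
  have y1 : A1 ((2 ^+ k)^-1%:C *: iter k v).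
    apply/(unit_ballP vA); split; first exact: (saZ vA).
    move=> x; rewrite !fctE ripZl; have /andP[b0 b1] := Pb k x.
    by rewrite mulr_ge0 ?invr_ge0 ?(ltW p2) //= ler_pdivrMl.
  have := wpos _ y1; rewrite (compZr _ _ lw) (trZ vM tauP); last by vna_mem.
  rewrite pmulr_rge0 ?invr_gt0 //.
  have -> : w \o iter k v = iter k v - iter k.+1 v.
    by apply/funext => x; rewrite /= !fctE iterS /v !fctE opprB addrC subrK.
  by rewrite (trB vM tauP) // subr_ge0.
have P1 k : tr (iter k v) <= 1.
  elim: k => [|k IH]; last exact: le_trans (Pdec k) IH.
  by have := tr_id tauP; rewrite /= => ->.
have PP i j c : iter i v \o (iter j v \o c) = iter (i + j) v \o c.
  by apply/funext => x; rewrite /= iterD.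
have [G GE] : exists G, forall k, G k = iter k v \o a.
  by exists (fun k => iter k v \o a).
have MG k : M (G k) by rewrite GE; exact: (vnaM vM (MP k) Ma).
pose s m := tr (G (m + m)%N).
have saMsa c : Asa c -> Msa c by exact: (sa_sub AM).
have a1 x : rip (a x) x <= nsq x by exact: (ball_le1 vM _ ha).
have a0 x : 0 <= rip (a x) x by exact: (ball_ge0 vM _ ha).
have tr_conj q : Asa q -> tr (q \o (q \o a)) = tr (q \o a \o q).
  by move=> /saMsa/saA Mq; rewrite (trC tauP Mq (vnaM vM Mq Ma)).
have s_le m : s m <= 1.
  apply: le_trans (P1 (m + m)%N); rewrite /s GE -PP tr_conj //.
  apply: (tr_le vM tauP) => [||x].
  - by apply: (sa_conj vM); [exact: saMsa|exact: (ball_sa vM)].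
  - exact: saMsa.
  - rewrite /= iterD (saE _ _ (hP m)) [leRHS](saE _ _ (hP m)); exact: a1.
have s_cvx m : 2 * s m.+1 <= s m + s m.+2.
  pose q := iter m v - iter m.+2 v.
  have hq : Asa q by exact: (saB vA).
  have : 0 <= tr (q \o (q \o a)).
    rewrite tr_conj //; apply: (tr_ge0 vM tauP) => [|x].
      by apply: (sa_conj vM); [exact: saMsa|exact: (ball_sa vM)].
    by rewrite /= (saE _ _ hq); exact: a0.
  have -> : q \o (q \o a) = G (m + m)%N - G (m.+1 + m.+1)%N -
      (G (m.+1 + m.+1)%N - G (m.+2 + m.+2)%N).
    have e1 : (m.+1 + m.+1 = m + m.+2)%N by rewrite !addSn !addnS.
    have e2 : (m.+1 + m.+1 = m.+2 + m)%N by rewrite !addSn !addnS.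
    rewrite {1}e1 e2 !GE -(PP m m) -(PP m m.+2) -(PP m.+2 m) -(PP m.+2 m.+2).
    have qE c : q \o c = (iter m v \o c) - (iter m.+2 v \o c) by [].
    by rewrite (qE (q \o a)) (qE a) !(compBr _ _ (sa_lin vA (hP _))).
  rewrite !(trB vM tauP) //; try by apply: (vnaB vM).
  by rewrite /s; lra.
have := convex_seq_bounded s_cvx s_le.
rewrite /s !GE /= -[tr (_ \o a)]/(tr (v \o (v \o a))).
have -> : v \o (v \o a) = a - (w \o a) - ((w \o a) - (w \o (w \o a))).
  have vE x : v x = x - w x by [].
  by apply/funext => x; rewrite -[LHS]/(v (v (a x))) !vE (linB lw).
rewrite !(trB vM tauP) //; try by vna_mem.
have : 0 <= tr (w \o (w \o a)).
  rewrite tr_conj //; apply: (tr_ge0 vM tauP) => [|x].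
    by apply: (sa_conj vM); [exact: saMsa|exact: (ball_sa vM)].
  by rewrite /= (saE _ _ hw); exact: a0.
rewrite -[id \o (id \o a)]/a; lra.
Qed.

End Positivity.

(** * Compact convex sets in finite dimension *)

Section Convex.
Context {R : realType} {n : nat}.
Local Notation V := ('rV[R]_n.+1).
Implicit Types (x y z u v : V) (r s t : R) (B C : set V).

Definition rV_dot u y : R := \sum_j u 0 j * y 0 j.

Lemma rV_dotC u y : rV_dot u y = rV_dot y u.
Proof. by apply: eq_bigr => j _; rewrite mulrC. Qed.

Lemma rV_dotDr u y z : rV_dot u (y + z) = rV_dot u y + rV_dot u z.
Proof.
by rewrite -big_split /=; apply: eq_bigr => j _; rewrite rV_addE mulrDr.
Qed.

Lemma rV_dotZr u r y : rV_dot u (r *: y) = r * rV_dot u y.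
Proof.
by rewrite mulr_sumr; apply: eq_bigr => j _; rewrite mxE mulrCA.
Qed.

Lemma rV_dotNr u y : rV_dot u (- y) = - rV_dot u y.
Proof. by rewrite -scaleN1r rV_dotZr mulN1r. Qed.

Lemma rV_dotBr u y z : rV_dot u (y - z) = rV_dot u y - rV_dot u z.
Proof. by rewrite rV_dotDr rV_dotNr. Qed.

Lemma rV_dotDl u v y : rV_dot (u + v) y = rV_dot u y + rV_dot v y.
Proof. by rewrite !(rV_dotC _ y) rV_dotDr. Qed.

Lemma rV_dotBl u v y : rV_dot (u - v) y = rV_dot u y - rV_dot v y.
Proof. by rewrite !(rV_dotC _ y) rV_dotBr. Qed.

Lemma rV_dotZl r u y : rV_dot (r *: u) y = r * rV_dot u y.
Proof. by rewrite !(rV_dotC _ y) rV_dotZr. Qed.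

Lemma rV_dot_comb t y z :
  rV_dot (t *: y + (1 - t) *: z) (t *: y + (1 - t) *: z) =
  t * rV_dot y y + (1 - t) * rV_dot z z - t * (1 - t) * rV_dot (y - z) (y - z).
Proof.
rewrite rV_dotBl !rV_dotBr rV_dotDl !rV_dotDr !rV_dotZl !rV_dotZr (rV_dotC z y).
by ring.
Qed.

Lemma rV_dot_ge0 y : 0 <= rV_dot y y.
Proof. by apply: sumr_ge0 => j _; rewrite -expr2 sqr_ge0. Qed.

Lemma rV_dot_eq0 y : rV_dot y y = 0 -> y = 0.
Proof.
move=> /eqP; rewrite psumr_eq0 => [/allP h|j _]; last by rewrite -expr2 sqr_ge0.
apply/rowP => j; have := h j (mem_index_enum j).
by rewrite -expr2 sqrf_eq0 mxE => /eqP.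
Qed.

Lemma rV_dot_delta j y : rV_dot (delta_mx 0 j) y = y 0 j.
Proof.
rewrite /rV_dot (bigD1 j) //= mxE !eqxx mul1r big1 ?addr0 // => i ij.
by rewrite mxE (negbTE ij) andbF mul0r.
Qed.

Lemma dot_continuous (f g : V -> V) : continuous f -> continuous g ->
  continuous (fun y => rV_dot (f y) (g y)).
Proof.
move=> cf cg y.
have c j (h : V -> V) : continuous h -> h z 0 j @[z --> y] --> h y 0 j.
  by move=> ch; apply: (@continuous_comp _ _ _ h (fun v : V => v 0 j));
    [exact: ch|exact: coord_continuous].
apply: (@cvg_big _ _ _ _ _ _ _ (nbhs y)) => [|j _]; first exact: add_continuous.
by apply: cvgM; exact: c.
Qed.

Definition segment_closed C := forall r y z, 0 <= r <= 1 -> C y -> C z ->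
  C (r *: y + (1 - r) *: z).

Lemma compact_maximum (f : V -> R) C : continuous f -> compact C -> C !=set0 ->
  exists2 c, C c & forall y, C y -> f y <= f c.
Proof.
move=> cf cC C0; have [|c cC' hc] := compact_EVT_max C0 cC (f := f).
  exact: continuous_subspaceT.
exists c; first by rewrite inE in cC'.
by move=> y Cy; apply: hc; rewrite inE.
Qed.

(** Among the maximizers of a linear form, a point of maximal Euclidean norm is
    extreme, the norm being strictly convex. *)
Lemma linear_max_extreme u B : compact B -> B !=set0 ->
  exists2 e, extreme_points B e & forall y, B y -> rV_dot u y <= rV_dot u e.
Proof.
move=> cB B0; have cu : continuous (rV_dot u).
  apply: (@dot_continuous (fun=> u) id); first exact: cst_continuous.
  by move=> y; exact: cvg_id.
have [c Bc hc] := compact_maximum cu cB B0.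
pose F := B `&` (rV_dot u) @^-1` [set s | rV_dot u c <= s].
have cF : compact F.
  apply: compact_closedI => //; apply: preimage_closed; last exact: closed_ge.
  by move=> y _; exact: cu.
have F0 : F !=set0 by exists c; split=> //=.
have [|e [Be ue] he] := compact_maximum _ cF F0 (f := fun y => rV_dot y y).
  by apply: (@dot_continuous id id) => y; exact: cvg_id.
exists e; last by move=> y /hc /le_trans; apply.
split=> // y z t By Bz /andP[t0 t1] ee.
have uy := hc _ By; have uz := hc _ Bz.
have e1 : rV_dot u e = t * rV_dot u y + (1 - t) * rV_dot u z.
  by rewrite ee rV_dotDr !rV_dotZr.
have t1' : 0 < 1 - t by lra.
have Fy : F y.
  split=> //=; rewrite leNgt; apply/negP => lt; move: ue; rewrite /= e1 => ue.
  have : t * rV_dot u y < t * rV_dot u c by rewrite ltr_pM2l.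
  have : (1 - t) * rV_dot u z <= (1 - t) * rV_dot u c by rewrite ler_pM2l.
  lra.
have Fz : F z.
  split=> //=; rewrite leNgt; apply/negP => lt; move: ue; rewrite /= e1 => ue.
  have : t * rV_dot u y <= t * rV_dot u c by rewrite ler_pM2l.
  have : (1 - t) * rV_dot u z < (1 - t) * rV_dot u c by rewrite ltr_pM2l.
  lra.
have := he _ Fy; have := he _ Fz => /= nz ny.
have en : rV_dot e e = t * rV_dot y y + (1 - t) * rV_dot z z -
    t * (1 - t) * rV_dot (y - z) (y - z).
  by rewrite {1}ee [X in rV_dot _ X]ee rV_dot_comb.
have yz0 : rV_dot (y - z) (y - z) = 0.
  apply/eqP; rewrite eq_le rV_dot_ge0 andbT.
  have h1 : t * rV_dot y y <= t * rV_dot e e by rewrite ler_pM2l.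
  have h2 : (1 - t) * rV_dot z z <= (1 - t) * rV_dot e e by rewrite ler_pM2l.
  rewrite -(pmulr_rle0 _ (mulr_gt0 t0 t1')); lra.
move/rV_dot_eq0/eqP : yz0; rewrite subr_eq0 => /eqP yz.
have -> : e = z by rewrite ee yz -scalerDl addrC subrK scale1r.
by rewrite yz.
Qed.

(** Strict separation, by the nearest point of [C]. *)
Lemma separation C x : compact C -> segment_closed C -> ~ C x ->
  exists u d, 0 < d /\ forall y, C y -> rV_dot u y + d <= rV_dot u x.
Proof.
move=> cC vC nx; have [C0|/set0P/negP/negPn/eqP C0] := pselect (C !=set0); last first.
  by exists 0, 1; split=> // y; rewrite C0.
pose f y := - rV_dot (y - x) (y - x).
have cB : continuous (fun y : V => y - x).
  by move=> y; apply: (@cvgB _ _ _ (nbhs y)); [exact: cvg_id|exact: cvg_cst].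
have cf : continuous f.
  by move=> y; apply: (@cvgN _ _ _ (nbhs y)); exact: (dot_continuous cB cB).
have [c Cc hc] := compact_maximum cf cC C0.
exists (x - c), (rV_dot (x - c) (x - c)); split.
  rewrite lt_def rV_dot_ge0 andbT; apply: contra_notN nx => /eqP/rV_dot_eq0/eqP.
  by rewrite subr_eq0 => /eqP ->.
move=> y Cy.
suff : rV_dot (x - c) (y - c) <= 0.
  by rewrite !(rV_dotBr (x - c)); lra.
have quad t : 0 <= t <= 1 ->
    2 * t * rV_dot (x - c) (y - c) <= t ^+ 2 * rV_dot (y - c) (y - c).
  move=> ht; have := hc _ (vC t y c ht Cy Cc); rewrite /f lerN2.
  have -> : t *: y + (1 - t) *: c - x = t *: (y - c) - (x - c).
    by rewrite scalerBl scale1r scalerBr opprB !addrA addrAC.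
  have -> : c - x = - (x - c) by rewrite opprB.
  move: (y - c) (x - c) => p q.
  rewrite rV_dotNr (rV_dotC (- _)) rV_dotNr opprK.
  rewrite rV_dotBl !rV_dotBr !rV_dotZl !rV_dotZr (rV_dotC p q); lra.
set N := rV_dot (y - c) (y - c) in quad; have N0 : 0 <= N by exact: rV_dot_ge0.
rewrite leNgt; apply/negP => P0; set P := rV_dot _ _ in quad P0.
pose t := P / (P + N).
have PN : 0 < P + N by lra.
have t0 : 0 < t by rewrite divr_gt0.
have t1 : t <= 1 by rewrite ler_pdivrMr //; lra.
have := quad t; rewrite t1 (ltW t0) => /(_ isT).
have -> : t ^+ 2 * N = t * (t * N) by ring.
have -> : 2 * t * P = t * (2 * P) by ring.
rewrite ler_pM2l //.
have : t * N <= P.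
  by rewrite /t mulrAC ler_pdivrMr // ler_pM2l //; lra.
lra.
Qed.

End Convex.

Section Slices.
Context {R : realType} {n : nat}.
Local Notation V := ('rV[R]_n.+1).
Implicit Types (x y z u v : V) (r s t : R) (B C : set V).

(** Convexity in homogeneous form, which absorbs the case of vanishing weights
    when joins are shown to be convex. *)
Lemma convex_cone C r s y z : segment_closed C -> 0 <= r -> 0 <= s ->
  C y -> C z ->
  exists2 w, C w & r *: y + s *: z = (r + s) *: w.
Proof.
move=> vC r0 s0 Cy Cz; have [rs|rs] := eqVneq (r + s) 0.
  have [-> ->] : r = 0 /\ s = 0 by split; lra.
  by exists y => //; rewrite addr0 !scale0r addr0.
have rs0 : 0 < r + s by rewrite lt_def rs addr_ge0.
exists (r / (r + s) *: y + (1 - r / (r + s)) *: z).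
  by apply: vC => //; rewrite divr_ge0 ?(ltW rs0) //= ler_pdivrMr //; lra.
rewrite scalerDr !scalerA; congr (_ *: _ + _ *: _); by field.
Qed.

Definition convex_join C1 C2 : set V :=
  [set x | exists r y z, [/\ 0 <= r <= 1, C1 y, C2 z & x = r *: y + (1 - r) *: z]].

Lemma convex_join_convex C1 C2 : segment_closed C1 -> segment_closed C2 ->
  segment_closed (convex_join C1 C2).
Proof.
move=> v1 v2 r _ _ /andP[r0 r1] [s [y [z [/andP[s0 s1] Cy Cz ->]]]]
  [s' [y' [z' [/andP[s0' s1'] Cy' Cz' ->]]]].
have r1' : 0 <= 1 - r by lra.
have [w Cw ew] := convex_cone v1 (mulr_ge0 r0 s0) (mulr_ge0 r1' s0') Cy Cy'.
have t0 : 0 <= 1 - s by lra.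
have t0' : 0 <= 1 - s' by lra.
have [w' Cw' ew'] := convex_cone v2 (mulr_ge0 r0 t0) (mulr_ge0 r1' t0') Cz Cz'.
exists (r * s + (1 - r) * s'), w, w'; split=> //.
  apply/andP; split; first by rewrite addr_ge0 // mulr_ge0.
  have := ler_wpM2l r0 s1; have := ler_wpM2l r1' s1'; lra.
have -> : 1 - (r * s + (1 - r) * s') = r * (1 - s) + (1 - r) * (1 - s') by ring.
by rewrite -ew -ew' !scalerDr !scalerA addrACA.
Qed.

Lemma comb_continuous :
  continuous (fun p : R * (V * V) => p.1 *: p.2.1 + (1 - p.1) *: p.2.2).
Proof.
move=> p; have c1 : p'.1 @[p' --> p] --> p.1 by exact: cvg_fst.
have c2 : p'.2 @[p' --> p] --> p.2 by exact: cvg_snd.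
apply: (@cvgD _ _ _ (nbhs p)).
  apply: (@cvgZ _ _ _ (nbhs p)) => //.
  by apply: cvg_comp c2 _; exact: cvg_fst.
apply: (@cvgZ _ _ _ (nbhs p)) => //.
  by apply: (@cvgB _ _ _ (nbhs p)) => //; exact: cvg_cst.
by apply: cvg_comp c2 _; exact: cvg_snd.
Qed.

Lemma convex_join_compact C1 C2 : compact C1 -> compact C2 ->
  compact (convex_join C1 C2).
Proof.
move=> c1 c2.
pose f (p : R * (V * V)) := p.1 *: p.2.1 + (1 - p.1) *: p.2.2.
have -> : convex_join C1 C2 = f @` (`[0, 1] `*` (C1 `*` C2)).
  apply/seteqP; split=> [x [r [y [z [hr Cy Cz ->]]]]|x [[r [y z]] /= [+ [Cy Cz]] <-]].
    by exists (r, (y, z)) => //=; split=> //; rewrite in_itv.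
  by rewrite in_itv /= => hr; exists r, y, z.
apply: continuous_compact; last first.
  apply: compact_setX; first exact: segment_compact.
  exact: compact_setX.
by apply: continuous_subspaceT; exact: comb_continuous.
Qed.

Lemma extreme_convex_join B C1 C2 x : extreme_points B x ->
  C1 `<=` B -> C2 `<=` B -> ~ C1 x -> ~ C2 x -> ~ convex_join C1 C2 x.
Proof.
move=> [Bx ext] s1 s2 n1 n2 [r [y [z [/andP[r0 r1] Cy Cz e]]]].
have [r00|r00] := eqVneq r 0.
  by apply: n2; rewrite e r00 scale0r add0r subr0 scale1r.
have [r11|r11] := eqVneq r 1.
  by apply: n1; rewrite e r11 scale1r subrr scale0r addr0.
have [|yx _] := ext y z r (s1 _ Cy) (s2 _ Cz) _ e.
  by rewrite !lt_def r00 r0 eq_sym r11 r1.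
by apply: n1; rewrite -yx.
Qed.

(** An extreme point lies on no proper segment of [B], so it enters the join of
    two subsets of [B] only through one of them; hence finitely many sets can be
    joined one after the other. *)
Lemma extreme_family (I : eqType) (F : I -> set V) (l : seq I) B x :
  segment_closed B -> extreme_points B x ->
  (forall i, [/\ compact (F i), segment_closed (F i), F i `<=` B & ~ F i x]) ->
  exists C, [/\ compact C, segment_closed C, C `<=` B, ~ C x &
    forall i, i \in l -> F i `<=` C].
Proof.
move=> vB ext hF; elim: l => [|i l [C [cC vC CB nC hC]]].
  by exists set0; split=> //; exact: compact0.
have [cF vF FB nF] := hF i.
have [F0|/set0P/negP/negPn/eqP F0] := pselect (F i !=set0); last first.
  exists C; split=> // j; rewrite in_cons => /orP[/eqP -> |/hC //].
  by rewrite F0.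
have [C0|/set0P/negP/negPn/eqP C0] := pselect (C !=set0); last first.
  exists (F i); split=> // j; rewrite in_cons => /orP[/eqP ->//|/hC].
  by rewrite C0 => /subset_trans; apply.
exists (convex_join (F i) C); split.
- exact: convex_join_compact.
- exact: convex_join_convex.
- by move=> _ [r [y [z [hr Fy Cz ->]]]]; apply: vB; [|exact: FB|exact: CB].
- exact: extreme_convex_join ext FB CB nF nC.
- move=> j; rewrite in_cons => /orP[/eqP -> y Fy|/hC FC y /FC Cy].
    have [z Cz] := C0; exists 1, y, z; split=> //; first by rewrite ler01 lexx.
    by rewrite scale1r subrr scale0r addr0.
  have [z Fz] := F0; exists 0, z, y; split=> //; first by rewrite ler01 lexx.
  by rewrite scale0r add0r subr0 scale1r.
Qed.

(** In the box norm the part of [B] outside a neighbourhood of [x] is covered by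
    finitely many compact convex sets, cut out by half-spaces. One compact convex
    set contains them all and still avoids [x], so it can be separated from
    [x]. *)
Lemma extreme_slice B x (W : set V) : compact B -> segment_closed B ->
  extreme_points B x -> nbhs x W ->
  exists u d, 0 < d /\
    forall y, B y -> ~ W y -> rV_dot u y + d <= rV_dot u x.
Proof.
move=> cB vB ext /nbhs_ballP[e /= e0 eW].
pose F (jb : 'I_n.+1 * bool) := B `&`
  (fun y : V => if jb.2 then y 0 jb.1 - x 0 jb.1 else x 0 jb.1 - y 0 jb.1) @^-1`
    [set s | e <= s].
have hF jb : [/\ compact (F jb), segment_closed (F jb), F jb `<=` B & ~ F jb x].
  case: jb => j b; split.
  - apply: compact_closedI => //; apply: preimage_closed; last exact: closed_ge.
    move=> y _; case: b => /=; apply: (@cvgB _ _ _ (nbhs y));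
      by [exact: coord_continuous|exact: cvg_cst].
  - move=> r y z hr [By hy] [Bz hz]; split; first exact: vB hr By Bz.
    have /andP[r0 r1] := hr.
    have r1' : 0 <= 1 - r by lra.
    have eE : e = r * e + (1 - r) * e by ring.
    rewrite /= rV_combE; case: b hy hz => /= hy hz; rewrite eE;
      have := ler_wpM2l r0 hy; have := ler_wpM2l r1' hz; lra.
  - by move=> y [].
  - by case=> _ /=; case: b; rewrite subrr leNgt e0.
have [C [cC vC _ nC hC]] := extreme_family (enum {: 'I_n.+1 * bool}) vB ext hF.
have [u [d [d0 hd]]] := separation cC vC nC.
exists u, d; split=> // y By nW; apply: hd.
have : ~ ball x e y by move=> /eW.
have [j hj] : exists j, e <= `|x 0 j - y 0 j|.
  apply: contrapT => /forallNP h; apply: nW; apply: eW; split=> // i j.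
  by rewrite (ord1 i) /ball /= ltNge; apply/negP; exact: h.
move=> _; have [le|lt] := leP (y 0 j) (x 0 j).
  apply: (hC (j, false)); first by rewrite mem_enum.
  by split=> //=; rewrite ger0_norm ?subr_ge0 // in hj.
apply: (hC (j, true)); first by rewrite mem_enum.
by split=> //=; rewrite distrC gtr0_norm ?subr_gt0 // in hj.
Qed.

(** By [extreme_slice] some [u] takes smaller values at the other extreme points
    than at [x], by a margin that survives small perturbations of [u]. A linear
    form is maximal on [B] at an extreme point, which can then only be [x].
    Perturbations along the axes are enough to recover each coefficient. *)
Lemma isolated_exposed B x : compact B -> segment_closed B ->
  isolated (extreme_points B) x ->
  exists u s, 0 < s /\ forall y, B y -> rV_dot u y <= rV_dot u x /\
    forall j, rV_dot u y + s * y 0 j <= rV_dot u x + s * x 0 j.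
Proof.
move=> cB vB [/set_mem ext [W xW iso]].
have [u [d [d0 hd]]] := extreme_slice cB vB ext xW.
have B0 : B !=set0 by exists x; case: ext.
have [K K0 hK] : exists2 K : R, 0 < K & forall y j, B y -> `|y 0 j - x 0 j| <= K.
  have cf j : continuous (fun y : V => `|y 0 j - x 0 j|).
    move=> y; apply: (@cvg_norm _ _ _ (nbhs y)).
    by apply: (@cvgB _ _ _ (nbhs y)); [exact: coord_continuous|exact: cvg_cst].
  have bnd j := compact_maximum (cf j) cB B0.
  pose c j := s2val (cid2 (bnd j)).
  have hc j y : B y -> `|y 0 j - x 0 j| <= `|c j 0 j - x 0 j|.
    by rewrite /c; case: cid2 => /= z _; exact.
  exists (1 + \sum_j `|c j 0 j - x 0 j|); first by rewrite ltr_wpDr // sumr_ge0.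
  move=> y j By; apply: le_trans (hc j y By) _.
  by rewrite (bigD1 j) //= addrCA lerDl addr_ge0 // sumr_ge0.
pose s := d / (K + 1).
have s0 : 0 < s by rewrite divr_gt0 //; lra.
have sK : s * K < d by rewrite /s mulrAC ltr_pdivrMr; [rewrite ltr_pM2l //; lra|lra].
exists u, s; split=> //.
have max v : (forall y, B y -> ~ W y -> rV_dot v y < rV_dot v x) ->
    forall y, B y -> rV_dot v y <= rV_dot v x.
  move=> hv; have [e ee he] := linear_max_extreme v cB B0.
  suff -> : x = e by [].
  have [Be _] := ee; have [We|/(hv _ Be)] := pselect (W e).
    have : (W `&` extreme_points B) e by [].
    by rewrite iso.
  by rewrite ltNge he //; case: ext.
move=> y By; split=> [|j].
  by apply: max By => z Bz nW; apply: lt_le_trans (hd z Bz nW); rewrite ltrDl.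
have uE z : rV_dot (u + s *: delta_mx 0 j) z = rV_dot u z + s * z 0 j.
  by rewrite rV_dotDl rV_dotZl rV_dot_delta.
rewrite -!uE; apply: max By => z Bz nW; rewrite !uE.
have := hd z Bz nW; have := ler_wpM2l (ltW s0) (hK z j Bz).
have : s * (z 0 j - x 0 j) <= s * `|z 0 j - x 0 j|.
  by rewrite ler_pM2l // ler_norm.
lra.
Qed.

(** The pairs of points of [B] whose [j]-th coordinates differ by at least [e]
    form a compact set; the compact set of their midpoints misses [x]. *)
Lemma extreme_midpoint B x j e : compact B -> extreme_points B x -> 0 < e ->
  exists2 W, nbhs x W & forall y z, B y -> B z ->
    W ((1 / 2) *: y + (1 - 1 / 2) *: z) -> y 0 j - z 0 j < e.
Proof.
move=> cB [Bx ext] e0.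
pose D := (B `*` B) `&` (fun p : V * V => p.1 0 j - p.2 0 j) @^-1` [set s | e <= s].
have cD : compact D.
  apply: compact_closedI; first exact: compact_setX.
  apply: preimage_closed; last exact: closed_ge.
  move=> p _; apply: (@cvgB _ _ _ (nbhs p)).
    apply: (@continuous_comp _ _ _ fst (fun v : V => v 0 j)); first exact: cvg_fst.
    exact: coord_continuous.
  apply: (@continuous_comp _ _ _ snd (fun v : V => v 0 j)); first exact: cvg_snd.
  exact: coord_continuous.
pose f (p : V * V) := (1 / 2) *: p.1 + (1 - 1 / 2) *: p.2.
have cf : continuous f.
  move=> p; apply: (@cvgD _ _ _ (nbhs p)).
    by apply: (@cvgZr _ _ _ (nbhs p)); exact: cvg_fst.
  by apply: (@cvgZr _ _ _ (nbhs p)); exact: cvg_snd.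
have cK : compact (f @` D).
  by apply: continuous_compact => //; exact: continuous_subspaceT.
exists (~` (f @` D)).
  apply: open_nbhs_nbhs; split.
    by rewrite openC; apply: compact_closed => //; exact: norm_hausdorff.
  move=> [[y z] /= [[/= By Bz] hyz] e1].
  have h : 0 < (1 / 2 : R) < 1 by apply/andP; split; lra.
  have [yx zx] := ext y z _ By Bz h (esym e1).
  by move: hyz; rewrite yx zx /= subrr leNgt e0.
move=> y z By Bz nW; rewrite ltNge; apply/negP => le.
by apply: nW; exists (y, z).
Qed.

End Slices.

(** * Generated algebras *)

Section Generated.
Context {R : realType} {H : completeNormedModType R[i]}.
Variable ip : {dot H for Num.conj}.
Hypothesis ip_norm : forall x : H, ip x x = `|x| ^+ 2.
Implicit Types (x y : H) (a p : H -> H) (A M G : set (H -> H)).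

Lemma commutantS A M : A `<=` M -> commutant M `<=` commutant A.
Proof. by move=> AM a [ba h]; split=> // s /AM; exact: h. Qed.

Lemma sub_bicommutant A : (forall a, A a -> bounded_operator a) ->
  A `<=` commutant (commutant A).
Proof. by move=> hA a Aa; split; [exact: hA|move=> s [_ /(_ a Aa) ->]]. Qed.

Lemma ip_ext x y : (forall z, ip z x = ip z y) -> x = y.
Proof.
move=> h; apply: (rip_ext ip_norm) => z.
by rewrite !(ripC ip _ z) /re_ip h.
Qed.

Lemma vna_bounded A a : von_neumann_algebra ip A -> A a -> bounded_operator a.
Proof.
by move=> vA Aa; split; [exact: (vna_lin vA)|exact: (vna_continuous vA)].
Qed.

(** Intersections of von Neumann algebras are von Neumann algebras, because
    adjoints are unique and commutants reverse inclusions. *)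
Lemma generated_vnaP M G : von_neumann_algebra ip M -> G `<=` M ->
  [/\ von_neumann_algebra ip (generated_vna ip M G), generated_vna ip M G `<=` M,
    G `<=` generated_vna ip M G &
    forall A, von_neumann_subalgebra ip M A -> G `<=` A ->
      generated_vna ip M G `<=` A].
Proof.
move=> vM GM; set N := generated_vna ip M G.
have NA A : von_neumann_subalgebra ip M A -> G `<=` A -> N `<=` A.
  move=> vA GA a; apply; split=> // c [/GA //|->].
  exact: vna_id (proj1 vA).
have NM : N `<=` M by apply: NA => //; split.
split=> //; last by move=> a Ga A [_ h]; apply: h; left.
split=> [a Na|].
  have [a' Ma' adj] := proj1 vM a (NM a Na).
  exists a' => // A hA; have [a'' Aa'' adj'] := proj1 (proj1 (proj1 hA)) a (Na A hA).
  suff -> : a' = a'' by [].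
  by apply/funext => y; apply: ip_ext => x; rewrite -adj -adj'.
apply/seteqP; split; last first.
  by apply: sub_bicommutant => a /NM; exact: vna_bounded.
move=> a ha A hA; have [[[_ AE] _] _] := hA; rewrite -AE.
by apply: commutantS ha; apply: commutantS => c Nc; exact: Nc A hA.
Qed.

(** With [generated_vnaP]: what commutes with the generators of an algebra
    commutes with the algebra. *)
Lemma commutant_subalgebra M p : von_neumann_algebra ip M -> M p ->
  selfadjoint ip p -> von_neumann_subalgebra ip M (M `&` commutant [set p]).
Proof.
move=> vM Mp sp; split; last by move=> a [].
set D := M `&` _; split=> [a [Ma [ba /(_ p erefl) ap]]|].
  have [a' Ma' adj] := proj1 vM a Ma; exists a' => //; split=> //; split.
    exact: (vna_bounded vM).
  move=> _ ->; apply/funext => y; apply: ip_ext => x /=.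
  have e : a (p x) = p (a x) := congr1 (@^~ x) ap.
  by rewrite -adj -sp -e adj sp.
apply/seteqP; split; last first.
  by apply: sub_bicommutant => a [Ma _]; exact: (vna_bounded vM).
move=> a ha; have Ma : M a.
  by rewrite -(proj2 vM); apply: commutantS ha; apply: commutantS => c [].
split=> //; split=> [|_ ->]; first exact: (vna_bounded vM).
have Dp : commutant D p.
  by split=> [|d [_ [_ /(_ p erefl) ->]]//]; exact: (vna_bounded vM).
by case: ha => _ /(_ p Dp).
Qed.

End Generated.

(** * Projections of a finite-dimensional algebra *)

Section FiniteDimension.
Context {R : realType} {H : completeNormedModType R[i]}.
Variable ip : {dot H for Num.conj}.
Hypothesis ip_norm : forall x : H, ip x x = `|x| ^+ 2.
Variables (M : set (H -> H)) (tau : (H -> H) -> R[i]).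
Hypothesis vM : von_neumann_algebra ip M.
Hypothesis tauP : faithful_normal_tracial_state ip M tau.
Local Notation nsq := (sqnorm ip).
Local Notation Msa := (selfadjoint_part ip M).
Local Notation tr := (rtrace tau).
Local Notation trsq := (rtrace_sq tau).
Implicit Types (x : H) (r s : R) (a c d e f v w : H -> H) (l : seq (H -> H)).

(** Real linear spans by recursion on the spanning family, the form in which
    Gram-Schmidt is an induction. *)
Fixpoint rspan l : set (H -> H) :=
  if l is e :: l' then
    [set a | exists r, exists2 c, rspan l' c & a = r%:C *: e + c]
  else [set 0].

Fixpoint all_sa l : Prop := if l is e :: l' then Msa e /\ all_sa l' else True.

Lemma rspan_sa l a : all_sa l -> rspan l a -> Msa a.
Proof.
elim: l a => [|e l IH] a /=; first by move=> _ ->; exact: (sa0 vM).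
move=> [he hl] [r [c hc ->]]; apply: (saD vM); first exact: (saZ vM).
exact: IH.
Qed.

Lemma rspanP l r a c : rspan l a -> rspan l c -> rspan l (r%:C *: a + c).
Proof.
elim: l a c => [|e l IH] a c /=; first by move=> -> ->; rewrite scaler0 addr0.
move=> [s [a' ha ->]] [s' [c' hc ->]].
exists (r * s + s'), (r%:C *: a' + c'); first exact: IH.
by rewrite scalerDr scalerA -rmorphM rmorphD scalerDl addrACA.
Qed.

Lemma rspan_sum (I : Type) (t : seq I) (h : I -> H -> H) (r : I -> R) :
  rspan [seq h i | i <- t] (\sum_(i <- t) (r i)%:C *: h i).
Proof.
elim: t => [|i t IH] /=; first by rewrite big_nil.
by rewrite big_cons; exists (r i); eexists; first exact: IH.
Qed.

Lemma all_sa_map (I : Type) (t : seq I) (h : I -> H -> H) :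
  (forall i, Msa (h i)) -> all_sa [seq h i | i <- t].
Proof. by move=> hh; elim: t. Qed.

Lemma all_sa_cat l l' : all_sa l -> all_sa l' -> all_sa (l ++ l').
Proof. by elim: l => //= e l IH [he hl] hl'; split=> //; exact: IH. Qed.

Lemma rspan_cat l l' a c : rspan l a -> rspan l' c -> rspan (l ++ l') (a + c).
Proof.
elim: l a => [|e l IH] a /=; first by move=> ->; rewrite add0r.
by move=> [r [a' ha ->]] hc; exists r, (a' + c); [exact: IH|rewrite addrA].
Qed.

(** Gram-Schmidt: [e = w0 + f] with [f] orthogonal to the previous vectors adds
    an orthogonal direction, unless [f = 0]. The two conclusions are proved
    together, since the projection onto the previous span provides [w0]. *)
Lemma rspan_orthogonal l : all_sa l ->
  (forall d, Msa d -> exists2 w, rspan l w &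
    forall v, rspan l v -> tr (v \o (d - w)) = 0) /\
  (exists2 K, 0 <= K &
    forall a, rspan l a -> forall x, nsq (a x) <= K * trsq a * nsq x).
Proof.
elim: l => [|e l IH] /=.
  move=> _; split=> [d hd|].
    exists 0 => // v ->; rewrite comp0l; exact: (tr0 vM tauP).
  by exists 0 => // a -> x; rewrite !mul0r /sqnorm rip0l.
move=> [he hl]; have [proj [K K0 hK]] := IH hl.
have [w0 hw0 orth] := proj e he; pose f := e - w0.
have sa_l a : rspan l a -> Msa a by exact: rspan_sa.
have hf : Msa f by apply: (saB vM) => //; exact: sa_l.
have dec r c : rspan l c -> exists2 c', rspan l c' & r%:C *: e + c = r%:C *: f + c'.
  move=> hc; exists (r%:C *: w0 + c); first exact: rspanP.
  by rewrite /f scalerBr addrA subrK.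
have fspan s w : rspan l w -> rspan (e :: l) (s%:C *: f + w).
  move=> hw; exists s, ((- s)%:C *: w0 + w); first exact: rspanP.
  by rewrite /f scalerBr rmorphN scaleNr addrA.
have Mf := saA hf.
have orth' a : rspan l a -> tr (f \o a) = 0 /\ tr (a \o f) = 0.
  by move=> ha; have Ma := saA (sa_l a ha); rewrite (trC tauP Mf Ma) orth.
clearbody f.
have [f0|f0] := eqVneq (trsq f) 0.
  have fE : f = 0 by apply: (trsq0_eq0 ip_norm vM tauP hf); rewrite f0.
  have dec0 a : rspan (e :: l) a -> rspan l a.
    by move=> [r [c /(dec r)[c' hc' ->] ->]]; rewrite fE scaler0 add0r.
  split=> [d /proj[w hw h]|]; last by exists K => // a /dec0; exact: hK.
  exists w => [|v /dec0]; last exact: h.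
  by have := fspan 0 w hw; rewrite scale0r add0r.
have fp : 0 < trsq f by rewrite lt_def f0 (trsq_ge0 ip_norm vM tauP).
split=> [d hd|].
  have [w hw h] := proj d hd; pose s := tr (f \o d) / trsq f.
  exists (s%:C *: f + w); first exact: fspan.
  move=> _ [r [c /(dec r)[c' hc' ->] ->]].
  have Md := saA hd; have Mw := saA (sa_l w hw); have Mc := saA (sa_l c' hc').
  have lf := sa_lin vM hf; have lc := sa_lin vM (sa_l c' hc').
  have -> : d - (s%:C *: f + w) = (d - w) - s%:C *: f by rewrite opprD addrA addrAC.
  have e1 : tr (f \o (d - w - s%:C *: f)) =
      tr (f \o d) - tr (f \o w) - s * trsq f.
    by rewrite !(compBr _ _ lf) (compZr _ _ lf) !(trB vM tauP) ?(trZ vM tauP) //;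
      vna_mem.
  have e2 : tr (c' \o (d - w - s%:C *: f)) =
      tr (c' \o (d - w)) - s * tr (c' \o f).
    by rewrite (compBr (d - w) _ lc) (compZr _ _ lc) (trB vM tauP) ?(trZ vM tauP) //;
      vna_mem.
  rewrite compDl compZl (trD tauP); try by vna_mem.
  rewrite (trZ vM tauP); last by vna_mem.
  rewrite e1 e2 (h _ hc') (orth' _ hc').2 (orth' _ hw).1 /s.
  by rewrite divfK // subr0 subrr !mulr0 subrr addr0.
have [C C0 hC] := continuous_bounded ip_norm (sa_lin vM hf) (vna_continuous vM Mf).
exists (2 * C / trsq f + 2 * K).
  apply: addr_ge0; last exact: mulr_ge0.
  by apply: divr_ge0; [exact: mulr_ge0|exact: ltW].
move=> _ [r [c /(dec r)[c' hc' ->] ->]] x.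
have tE : trsq (r%:C *: f + c') = r ^+ 2 * trsq f + trsq c'.
  rewrite (trsqD vM tauP (saZ vM _ hf) (sa_l _ hc')) (trsqZ vM tauP _ hf).
  rewrite compZl (trZ vM tauP) ?(orth' _ hc').1 ?mulr0 ?addr0 //.
  by have Mc := saA (sa_l c' hc'); vna_mem.
rewrite tE !fctE; apply: le_trans (nsqD_le ip_norm _ _) _; rewrite nsqZ.
have h1 := hK _ hc' x; have h2 := hC x.
have t0 : 0 <= trsq c' by apply: (trsq_ge0 ip_norm vM tauP); exact: sa_l.
have n0 : 0 <= nsq x by exact: nsq_ge0.
have h3 : r ^+ 2 * nsq (f x) <= r ^+ 2 * (C * nsq x).
  by apply: ler_wpM2l => //; exact: sqr_ge0.
have -> : (2 * C / trsq f + 2 * K) * (r ^+ 2 * trsq f + trsq c') * nsq x =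
   2 * (r ^+ 2 * (C * nsq x)) + 2 * (K * trsq c' * nsq x) +
   (2 * C / trsq f * trsq c' + 2 * K * (r ^+ 2 * trsq f)) * nsq x by field.
have : 0 <= (2 * C / trsq f * trsq c' + 2 * K * (r ^+ 2 * trsq f)) * nsq x.
  have Kf : 0 <= 2 * C / trsq f.
    by apply: divr_ge0; [exact: mulr_ge0|exact: ltW].
  apply: mulr_ge0 => //; apply: addr_ge0; apply: mulr_ge0 => //.
    exact: mulr_ge0.
  by apply: mulr_ge0; [exact: sqr_ge0|exact: ltW].
lra.
Qed.

Variable A : set (H -> H).
Hypothesis vA : von_neumann_algebra ip A.
Hypothesis AM : A `<=` M.
Local Notation Asa := (selfadjoint_part ip A).

(** A selfadjoint element is half the sum of itself and its adjoint, and
    [c e + (c e)'], for an element [e] with adjoint [e'], is the real combination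
    of [e + e'] and ['i (e - e')] with coefficients the real and imaginary parts
    of [c]. *)
Lemma finite_dim_rspan : finite_dim A ->
  exists2 l, all_sa l & Asa `<=` rspan l.
Proof.
move=> [k [e [Ae span]]].
have [e' he'] := choice (fun i => let: ex_intro2 a h1 h2 := proj1 vA _ (Ae i) in
  ex_intro (fun a => A a /\ adjoint ip (e i) a) a (conj h1 h2)).
have Ae' i : A (e' i) := proj1 (he' i).
have adj i : adjoint ip (e i) (e' i) := proj2 (he' i).
have adjC i x y : ip (e' i x) y = ip x (e i y).
  by rewrite (ipC ip y) -adj -(ipC ip).
pose h i := e i + e' i; pose g i := 'i%C *: e i - 'i%C *: e' i.
have hE i x : h i x = e i x + e' i x by [].
have gE i x : g i x = 'i%C *: e i x - 'i%C *: e' i x by [].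
have Ah i : A (h i) by exact: (vnaD vA).
have Ag i : A (g i) by apply: (vnaB vA); exact: (vnaZ vA).
clearbody h g.
have ci : conjc ('i%C : R[i]) = - 'i%C.
  by apply/eqP; rewrite eq_complex /= oppr0 !eqxx.
have hsa i : Msa (h i).
  apply: (sa_sub AM); split=> //.
  move=> x y; rewrite !hE linearDl linearDr addrC.
  by congr (_ + _); [exact: adjC|exact: adj].
have gsa i : Msa (g i).
  apply: (sa_sub AM); split=> //.
  move=> x y; rewrite !gE linearBl linearBr !linearZl_LR !linearZr_LR.
  transitivity ('i%C * ip x (e' i y) - 'i%C * ip x (e i y)).
    by congr (_ * _ - _ * _); [exact: adj|exact: adjC].
  rewrite -[RHS]/(conjc 'i%C * ip x (e i y) - conjc 'i%C * ip x (e' i y)).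
  by rewrite ci !mulNr opprK addrC.
exists ([seq h i | i <- enum 'I_k] ++ [seq g i | i <- enum 'I_k]).
  by apply: all_sa_cat; exact: all_sa_map.
move=> a [Aa sa]; have [c ac] := span a Aa.
have aE x : a x = \sum_i c i *: e i x by rewrite ac fct_sumE.
have aE' x : a x = \sum_i conjc (c i) *: e' i x.
  apply: (ip_ext ip_norm) => z; rewrite -sa aE linear_sumlz linear_sumr.
  apply: eq_bigr => i _; rewrite linearZl_LR linearZr_LR.
  by congr (_ * _); [exact/esym/conjcK|exact: adj].
have -> : a = \sum_(i <- enum 'I_k) (complex.Re (c i) / 2)%:C *: h i +
    \sum_(i <- enum 'I_k) (complex.Im (c i) / 2)%:C *: g i.
  apply/funext => x; rewrite !fctE !fct_sumE !big_enum /= -big_split /=.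
  have -> : a x = 2^-1%:C *: (a x + a x).
    have h2 : 2^-1 + 2^-1 = 1 :> R by lra.
    by rewrite scalerDr -scalerDl -rmorphD h2 scale1r.
  rewrite {1}aE aE' -big_split scaler_sumr /=; apply: eq_bigr => i _.
  rewrite -[LHS]/(_ *: (_ + _)) !fctE hE gE.
  rewrite !scalerDr scalerN !scalerA addrACA -!scalerDl -scalerBl.
  by congr (_ *: _ + _ *: _); case: (c i) => p q; apply/eqP;
    rewrite eq_complex /=; apply/andP; split; apply/eqP; field.
by apply: rspan_cat; exact: rspan_sum.
Qed.

(** In a finite-dimensional algebra the operator norm is bounded by a multiple
    of the trace norm, and nonzero projections have operator norm [1]. *)
Lemma finite_dim_trace_gap : finite_dim A -> exists2 d, 0 < d &
  forall p, Asa p -> p \o p = p -> tr p < d -> p = 0.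
Proof.
move=> /finite_dim_rspan[l hl Al].
have [_ [K K0 hK]] := rspan_orthogonal hl.
have K1 : 0 < K + 1 by lra.
exists (K + 1)^-1; first by rewrite invr_gt0.
move=> p hp pp tp; apply/funext => x; apply: (nsq0_eq0 ip_norm).
have pE y : p (p y) = p y by have := congr1 (@^~ y) pp.
have := hK p (Al p hp) (p x); rewrite pE /rtrace_sq pp => h.
have n0 := nsq_ge0 ip_norm (p x).
apply/eqP; rewrite eq_le n0 andbT leNgt; apply/negP => n1.
have : K * tr p < 1.
  have t0 : 0 <= tr p.
    have := trsq_ge0 ip_norm vM tauP (sa_sub AM hp).
    by rewrite /rtrace_sq pp.
  have : (K + 1) * tr p < 1 by rewrite mulrC -ltr_pdivlMr // div1r.
  lra.
by rewrite -(ltr_pM2r n1) mul1r ltNge h.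
Qed.

End FiniteDimension.

(** * The spectral scale of the generated algebra *)

Section SupportFunctions.
Context {R : realType} {H : completeNormedModType R[i]}.
Variable ip : {dot H for Num.conj}.
Hypothesis ip_norm : forall x : H, ip x x = `|x| ^+ 2.
Variables (M : set (H -> H)) (tau : (H -> H) -> R[i]).
Hypothesis vM : von_neumann_algebra ip M.
Hypothesis tauP : faithful_normal_tracial_state ip M tau.
Variables (n : nat) (b : 'I_n -> H -> H).
Local Notation rip := (re_ip ip).
Local Notation nsq := (sqnorm ip).
Local Notation Msa := (selfadjoint_part ip M).
Local Notation M1 := (positive_unit_ball ip M).
Local Notation tr := (rtrace tau).
Hypothesis bM : forall i, Msa (b i).
Local Notation coef := (coefs b).
Local Notation Psi := (spectral_map tau b).
Variable N : set (H -> H).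
Hypothesis vN : von_neumann_algebra ip N.
Hypothesis NM : N `<=` M.
Hypothesis bN : forall i, N (b i).
Local Notation Nsa := (selfadjoint_part ip N).
Local Notation N1 := (positive_unit_ball ip N).
Local Notation BM := (spectral_scale ip M tau b).
Local Notation BN := (spectral_scale ip N tau b).
Implicit Types (x : H) (y z u : 'rV[R]_n.+1) (r s : R) (a c p q : H -> H).

Let N1M a : N1 a -> M a. Proof. by case=> /NM. Qed.
Let NsaM a : Nsa a -> M a. Proof. by case=> /NM. Qed.

(** The element of [N] that represents the linear form [rV_dot u]. *)
Definition coef_comb u : H -> H := \sum_j (u 0 j)%:C *: coef j.

Lemma coef_N j : Nsa (coef j).
Proof.
rewrite /coefs; case: unlift => [i|]; last exact: (sa_id vN).
by split; [exact: bN|exact: (sa_adj (bM i))].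
Qed.

Lemma coef_comb_sa u : Nsa (coef_comb u).
Proof.
rewrite /coef_comb; elim/big_ind: _ => [|c d|j _].
- exact: (sa0 vN).
- exact: (saD vN).
- by apply: (saZ vN); exact: coef_N.
Qed.

Lemma tr_coef_comb u a : M a -> tr (coef_comb u \o a) = rV_dot u (Psi a).
Proof.
move=> Ma; have -> : coef_comb u \o a = \sum_j (u 0 j)%:C *: (coef j \o a).
  by apply/funext => x; rewrite /coef_comb /= !fct_sumE.
have Mc j : M (coef j \o a).
  by apply: (vnaM vM) => //; apply: NsaM; exact: coef_N.
have [_ ->] : M (\sum_j (u 0 j)%:C *: (coef j \o a)) /\
    tr (\sum_j (u 0 j)%:C *: (coef j \o a)) = \sum_j u 0 j * tr (coef j \o a).
  apply: (big_ind2 (fun c s => M c /\ tr c = s)) => [|c r d s [Mc' <-] [Md <-]|j _].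
  - by split; [exact: (vna0 vM)|exact: (tr0 vM tauP)].
  - by rewrite (trD tauP) //; split=> //; exact: (vnaD vM).
  - by rewrite (trZ vM tauP) //; split=> //; exact: (vnaZ vM).
by apply: eq_bigr => j _; rewrite spectral_mapE.
Qed.

(** [tr ((c p) a)] is the value of [tr (c a)] at the corner [p a p], so the sign
    of [tr (c a)] on the corner of [N] decides on the sign of [tr ((c p) a)] on
    the unit interval of [N], and by [subalgebra_positive] on that of [M]. *)
Lemma corner_positive c p : Nsa c -> Nsa p -> p \o p = p -> p \o c = c \o p ->
  (forall a, N1 a -> 0 <= tr (c \o (p \o (a \o p)))) ->
  forall a, M1 a -> 0 <= tr ((c \o p) \o a).
Proof.
move=> hc hp pp pc hpos a ha.
have hw : Nsa (c \o p) by apply: (saM vN) => //; exact/esym.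
have [r r0 hr] := vna_sa_bounded ip_norm vN hw.
have Ma : M a by case: ha.
have Mw := NsaM hw; have Mc := NsaM hc; have Mp := NsaM hp.
have ir : 0 < r^-1 by rewrite invr_gt0.
have : 0 <= tr ((r^-1%:C *: (c \o p)) \o a).
  apply: (subalgebra_positive ip_norm vM tauP vN NM) ha; first exact: (saZ vN).
    move=> x; rewrite !fctE ripZl; have /andP[h1 h2] := hr x.
    by rewrite -(ler_pM2l ir) mulrN !mulKf ?gt_eqF // in h1;
      rewrite -(ler_pM2l ir) mulKf ?gt_eqF // in h2; apply/andP.
  move=> d hd; have Md := N1M hd.
  rewrite compZl (trZ vM tauP); last by vna_mem.
  rewrite mulr_ge0 ?(ltW ir) //.
  have -> : (c \o p) \o d = p \o (c \o (p \o d)).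
    by rewrite -[RHS]/((p \o c) \o (p \o d)) pc -{1}pp.
  rewrite (trC tauP Mp); last by vna_mem.
  exact: hpos hd.
rewrite compZl (trZ vM tauP); last by vna_mem.
by rewrite pmulr_rge0.
Qed.

(** Both spectral scales are compact and convex, so it suffices to compare
    their support functions. The maximum of [tr (c a)] over the unit interval
    of [N] is attained at a projection [p] of [N] that commutes with [c];
    then [c p >= 0] and [c (1 - p) <= 0] first against [N], and by
    [subalgebra_positive] against [M] as well. *)
Lemma spectral_scale_sub : BM = BN.
Proof.
apply/seteqP; split=> [y [a ha <-]|y [a ha <-]]; last first.
  by exists a => //; exact: (ball_sub NM).
apply: contrapT => nB.
have cN : compact BN by exact: (scale_compact ip_norm vM tauP bM vN NM).
have vBN : segment_closed BN.
  by move=> r z z'; exact: (scale_convex vM tauP bM vN NM).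
have [u [d [d0 hd]]] := separation cN vBN nB.
have BN0 : BN !=set0.
  exists (Psi 0), 0 => //; apply/(unit_ballP vN); split; first exact: (sa0 vN).
  by move=> x; rewrite rip0l lexx (nsq_ge0 ip_norm).
have [e ext he] := linear_max_extreme u cN BN0.
have [[p hp pe] _] := ext; rewrite -{e}pe in ext he.
have pp := extreme_idem ip_norm vM tauP bM vN NM hp ext.
have hps := ball_sa vN hp.
pose c := coef_comb u; have hc : Nsa c by exact: coef_comb_sa.
have cmax c' : N1 c' -> tr (c \o c') <= tr (c \o p).
  move=> hz; rewrite !tr_coef_comb; [|exact: N1M..].
  by apply: he; exists c'.
have pc := maximizer_commutes ip_norm vM tauP vN NM hp hc cmax.
have lp := sa_lin vN hps; have lc := sa_lin vN hc.
have Mp := N1M hp; have Mc := NsaM hc; have Ma : M a by case: ha.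
have pE x : p (p x) = p x by have := congr1 (@^~ x) pp.
pose q : H -> H := id - p.
have qE x : q x = x - p x by [].
have hq : Nsa q by apply: (saB vN) => //; exact: sa_id.
have Mq := NsaM hq; clearbody q.
have lq := sa_lin vN hq.
have qq : q \o q = q.
  by apply/funext => x; rewrite /= !qE (linB lp) pE subrr subr0.
have qc : q \o c = c \o q.
  apply/funext => x; rewrite /= !qE (linB lc).
  by have := congr1 (@^~ x) pc => /= ->.
have nq x : nsq (p x) + nsq (q x) = nsq x.
  have -> : nsq (p x) = rip (p x) x by rewrite /nsq (saE _ _ hps) pE ripC.
  have -> : nsq (q x) = rip (q x) x.
    by rewrite /nsq (saE _ _ hq) -[q (q x)]/((q \o q) x) qq ripC.
  by rewrite qE ripDl ripNl addrC subrK.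
(* [p - p z p] stays in the unit interval, so [tr (c p z p) >= 0]. *)
have pos_p : forall a, M1 a -> 0 <= tr ((c \o p) \o a).
  apply: corner_positive => // z hz; have hzs := ball_sa vN hz.
  have Mz := N1M hz.
  have : N1 (p - (p \o (z \o p))).
    apply/(unit_ballP vN); split; first apply: (saB vN) => //.
      exact: (sa_conj vN hps hzs).
    move=> x; rewrite !fctE ripDl ripNl /= (saE (z (p x)) x hps).
    have -> : rip (p x) x = nsq (p x) by rewrite /nsq (saE x (p x) hps) pE ripC.
    have := ball_ge0 vN (p x) hz; have := ball_le1 vN (p x) hz.
    have := nq x; have := nsq_ge0 ip_norm (q x).
    by move=> ? ? ? ?; apply/andP; split; lra.
  move/cmax; rewrite (compBr _ _ lc) (trB vM tauP); try by vna_mem.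
  lra.
(* [p + q z q] stays in the unit interval, so [tr (c q z q) <= 0]. *)
have pos_q : forall a, M1 a -> 0 <= tr ((- c \o q) \o a).
  apply: corner_positive => //; first exact: (saN vN).
    by rewrite (compNr _ lq) qc.
  move=> z hz; have hzs := ball_sa vN hz.
  have Mz := N1M hz.
  have : N1 (p + (q \o (z \o q))).
    apply/(unit_ballP vN); split; first apply: (saD vN) => //.
      exact: (sa_conj vN hq hzs).
    move=> x; rewrite !fctE ripDl /= (saE (z (q x)) x hq).
    have -> : rip (p x) x = nsq (p x) by rewrite /nsq (saE x (p x) hps) pE ripC.
    have := ball_ge0 vN (q x) hz; have := ball_le1 vN (q x) hz.
    have := nq x; have := nsq_ge0 ip_norm (p x).
    by move=> ? ? ? ?; apply/andP; split; lra.
  move/cmax; rewrite (compDr _ _ lc) (trD tauP); try by vna_mem.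
  rewrite -[- c \o _]/(- (c \o (q \o (z \o q)))) (trN vM tauP); last by vna_mem.
  lra.
have h1a : M1 (id - a).
  apply/(unit_ballP vM); split.
    by apply: (saB vM); [exact: sa_id|exact: (ball_sa vM)].
  move=> x; rewrite !fctE ripDl ripNl -/(nsq x).
  have := ball_ge0 vM x ha; have := ball_le1 vM x ha.
  by move=> ? ?; apply/andP; split; lra.
have B : BN (Psi p) by exists p.
have := hd _ B; rewrite -!tr_coef_comb // -/c.
have := pos_p _ h1a; have := pos_q _ ha.
have lcp : linear (c \o p) by move=> k v w; rewrite /= lp lc.
rewrite (compBr _ _ lcp) (trB vM tauP) //; try by vna_mem.
rewrite -[(- c \o q) \o a]/(- ((c \o q) \o a)) (trN vM tauP); last by vna_mem.
have -> : tr (c \o a) = tr ((c \o p) \o a) + tr ((c \o q) \o a).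
  rewrite -(trD tauP); try by vna_mem.
  congr tr; apply/funext => x; rewrite !fctE /= -(linD lc) qE.
  by congr c; rewrite addrC subrK.
lra.
Qed.

End SupportFunctions.

(** * Isolated extreme points *)

Section IsolatedPoints.
Context {R : realType} {H : completeNormedModType R[i]}.
Variable ip : {dot H for Num.conj}.
Hypothesis ip_norm : forall x : H, ip x x = `|x| ^+ 2.
Variables (M : set (H -> H)) (tau : (H -> H) -> R[i]).
Hypothesis vM : von_neumann_algebra ip M.
Hypothesis tauP : faithful_normal_tracial_state ip M tau.
Variables (n : nat) (b : 'I_n -> H -> H).
Local Notation Msa := (selfadjoint_part ip M).
Local Notation tr := (rtrace tau).
Local Notation trsq := (rtrace_sq tau).
Hypothesis bM : forall i, Msa (b i).
Local Notation Psi := (spectral_map tau b).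
Local Notation N := (generated_vna ip M (range b)).
Local Notation N1 := (positive_unit_ball ip N).
Local Notation BN := (spectral_scale ip N tau b).

Let genP : [/\ von_neumann_algebra ip N, N `<=` M, range b `<=` N &
  forall A, von_neumann_subalgebra ip M A -> range b `<=` A -> N `<=` A].
Proof. by apply: (generated_vnaP ip_norm vM) => _ [i _ <-]; case: (bM i). Qed.

Let vN : von_neumann_algebra ip N. Proof. by case: genP. Qed.
Let NM : N `<=` M. Proof. by case: genP. Qed.
Let bN i : N (b i). Proof. by case: genP => _ _ + _; apply; exists i. Qed.

Let BN_compact : compact BN.
Proof. exact: (scale_compact ip_norm vM tauP bM vN NM). Qed.

Let BN_convex : segment_closed BN.
Proof. by move=> r y z; exact: (scale_convex vM tauP bM vN NM). Qed.

(** The projection [p] over an isolated point maximizes [tr (c_u a)] for all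
    [u] in an open set, so it commutes with all the [c_u], hence with every
    [b_i], hence with the algebra that they generate. *)
Lemma isolated_central y : isolated (extreme_points BN) y ->
  exists2 p, central_projection ip N p & y = Psi p.
Proof.
move=> iso; have [/set_mem ext _] := iso; have [[p hp py] _] := ext.
rewrite -{}py in iso ext *; exists p => //.
have pp := extreme_idem ip_norm vM tauP bM vN NM hp ext.
have [Np sp] := ball_sa vN hp.
have [u [s [s0 umax]]] := isolated_exposed BN_compact BN_convex iso.
have NsaP v : (forall y, BN y -> rV_dot v y <= rV_dot v (Psi p)) ->
    p \o coef_comb b v = coef_comb b v \o p.
  move=> hv; apply: (maximizer_commutes ip_norm vM tauP vN NM hp).
    exact: (coef_comb_sa bM vN bN).
  move=> d hd; have MN a : N1 a -> M a by case=> /NM.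
  rewrite !(tr_coef_comb vM tauP bM vN NM bN); [|exact: MN..].
  by apply: hv; exists d.
have comm i : p \o b i = b i \o p.
  pose j := lift ord0 i; pose v := u + s *: delta_mx 0 j.
  have cu : p \o coef_comb b u = coef_comb b u \o p.
    by apply: NsaP => z /umax[].
  have cv : p \o coef_comb b v = coef_comb b v \o p.
    apply: NsaP => z /umax[_ /(_ j)].
    by rewrite !rV_dotDl !rV_dotZl !rV_dot_delta.
  have lp := vna_lin vN Np.
  have vE : coef_comb b v = coef_comb b u + s%:C *: b i.
    transitivity (\sum_(k < n.+1) ((u 0 k)%:C *: coefs b k +
        (s * (delta_mx 0 j : 'rV[R]_n.+1) 0 k)%:C *: coefs b k)).
      by apply: eq_bigr => k _; rewrite -scalerDl -rmorphD; congr (_%:C *: _);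
        rewrite !mxE.
    rewrite big_split /=; congr (_ + _); rewrite (bigD1 j) //= big1 ?addr0.
      by rewrite mxE !eqxx mulr1 /coefs liftK.
    by move=> k kj; rewrite mxE (negbTE kj) andbF mulr0 rmorph0 scale0r.
  apply/funext => x; have := congr1 (@^~ x) cv; have := congr1 (@^~ x) cu.
  rewrite vE /= !fctE (linD lp) (linZ lp) => -> /addrI.
  have sC : s%:C != 0 by rewrite eq_complex /= gt_eqF.
  exact: (scalerI sC).
split=> // a Na; have [_ _ _ NA] := genP.
have /NA : von_neumann_subalgebra ip M (M `&` commutant [set p]).
  by apply: commutant_subalgebra => //; exact: NM.
move=> h; have [|_ [_ /(_ p erefl) ->]//] := h _ a Na.
move=> _ [i _ <-]; split; first by case: (bM i).
split; first by apply: (vna_bounded vN).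
by move=> _ ->; rewrite comm.
Qed.

(** Extreme points [Psi q] near [y = Psi p] have [tr ((p - q)^2)] small, because
    the midpoint of [p] and [q] is nearly idempotent. For central [p] the
    element [(p - q)^2] is a projection of [N], and in finite dimension the
    trace of a nonzero projection is bounded below. *)
Lemma central_isolated y p : finite_dim N -> extreme_points BN y ->
  central_projection ip N p -> y = Psi p -> isolated (extreme_points BN) y.
Proof.
move=> fd ext [Np [sp pp] pc] yp.
have lp := vna_lin vN Np.
have hps : selfadjoint_part ip N p by [].
have hp : N1 p.
  apply/(unit_ballP vN); split=> // x.
  have -> : re_ip ip (p x) x = sqnorm ip (p x).
    by rewrite /sqnorm (saE x (p x) hps) -[p (p x)]/((p \o p) x) pp ripC.
  have := nsq_ge0 ip_norm (p x); have := nsq_ge0 ip_norm (x - p x).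
  have : re_ip ip x (p x) = sqnorm ip (p x).
    by rewrite /sqnorm (saE x (p x) hps) -[p (p x)]/((p \o p) x) pp.
  by rewrite nsqB => -> ? ?; apply/andP; split; lra.
have [d d0 gap] := finite_dim_trace_gap ip_norm vM tauP vN NM fd.
have d2 : 0 < d / 2 by lra.
have [W yW near_y] := extreme_midpoint ord0 BN_compact ext d2.
split; first exact/mem_set.
pose mid (z : 'rV[R]_n.+1) := (1 / 2) *: y + (1 - 1 / 2) *: z.
have mid_y : mid y = y by rewrite /mid -scalerDl addrC subrK scale1r.
exists (mid @^-1` W).
  have : {for y, continuous mid}.
    apply: (@cvgD _ _ _ (nbhs y)); first exact: cvg_cst.
    by apply: (@cvgZr _ _ _ (nbhs y)); exact: cvg_id.
  by apply; rewrite mid_y.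
apply/seteqP; split=> [z [/= Wz extz]|_ ->]; last first.
  by split=> //=; rewrite mid_y; exact: nbhs_singleton.
have [[q hq zq] _] := extz; rewrite -{}zq in Wz extz *.
have qq := extreme_idem ip_norm vM tauP bM vN NM hq extz.
have hqs := ball_sa vN hq; have Nq := saA hqs; have lq := sa_lin vN hqs.
have Mp := NM Np; have Mq := NM Nq.
have pqs := saB vN hps hqs.
suff pq : p - q = 0.
  by rewrite yp; move/eqP: pq; rewrite subr_eq0 => /eqP ->.
pose m := (1 / 2)%:C *: p + (1 - 1 / 2)%:C *: q.
have hm : N1 m by apply: (ball_convex vN) => //; lra.
have Mm : M m by case: hm => /NM.
have mE : Psi m = mid (Psi q).
  rewrite /mid yp (Psi_D vM tauP bM (vnaZ vM _ Mp) (vnaZ vM _ Mq)).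
  by rewrite (Psi_Z vM tauP bM _ Mp) (Psi_Z vM tauP bM _ Mq).
have Mm2 : M (m \o m) by vna_mem.
have close : 2 * (tr m - trsq m) < d / 2.
  have B1 : BN (Psi (m + (m - (m \o m)))).
    by exists (m + (m - (m \o m))) => //; exact: (ball_2B_sqr ip_norm vN).
  have B2 : BN (Psi (m \o m)) by exists (m \o m) => //; exact: (ball_sqr ip_norm vN).
  have := near_y _ _ B1 B2.
  rewrite (Psi_D vM tauP bM Mm (vnaB vM Mm Mm2)) (Psi_B vM tauP bM Mm Mm2).
  rewrite rV_addE rV_subE -!(Psi_tr tau b) -/(trsq m).
  have -> : 1 / 2 *: (Psi m + (Psi m - Psi (m \o m))) +
      (1 - 1 / 2) *: Psi (m \o m) = mid (Psi q).
    by rewrite -mE; apply/rowP => j; rewrite rV_combE rV_addE rV_subE; lra.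
  by move=> /(_ Wz); lra.
have := trsq_mid vM tauP (sa_sub NM hps) (sa_sub NM hqs); rewrite -/m => tm.
have trm : tr m = tr p / 2 + tr q / 2.
  rewrite /m (trD tauP) ?(trZ vM tauP) //; try by vna_mem.
  by lra.
have small : trsq (p - q) < d.
  have tp : trsq p = tr p by rewrite /rtrace_sq pp.
  have tq : trsq q = tr q by rewrite /rtrace_sq qq.
  by move: close; rewrite tm trm tp tq; lra.
apply: (trsq0_eq0 ip_norm vM tauP (sa_sub NM pqs)).
suff e0 : (p - q) \o (p - q) = 0 by rewrite /rtrace_sq e0 (tr0 vM tauP).
apply: gap small; first exact: (sa_sqr vN).
have pE x : p (p x) = p x by have := congr1 (@^~ x) pp.
have qE x : q (q x) = q x by have := congr1 (@^~ x) qq.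
have pqE x : p (q x) = q (p x) by have := congr1 (@^~ x) (pc q Nq).
(* [(p - q)^3 = p - q], whence [(p - q)^2] is idempotent. *)
have cube x : (p - q) ((p - q) ((p - q) x)) = (p - q) x.
  rewrite !fctE !(linB lp, linB lq) !pE !qE !pqE !qE !pE.
  by rewrite !subrr subr0 sub0r opprK subrKA.
by apply/funext => x; exact: cube ((p - q) x).
Qed.

End IsolatedPoints.

Theorem theorem5p4 (R : realType) (H : completeNormedModType R[i])
    (ip : {dot H for Num.conj}) (ip_norm : forall x : H, ip x x = `|x| ^+ 2)
    (M : set (H -> H)) (tau : (H -> H) -> R[i])
    (M_vna : von_neumann_algebra ip M) (M_finite : finite_vna ip M)
    (tau_trace : faithful_normal_tracial_state ip M tau)
    (n : nat) (n_gt0 : (0 < n)%N) (b : 'I_n -> H -> H)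
    (b_sa : forall i, M (b i) /\ selfadjoint ip (b i)) :
  let N := generated_vna ip M (range b) in
  let Psi := spectral_map tau b in
  let B := spectral_scale ip M tau b in
  (forall x, isolated (extreme_points B) x ->
     exists2 p, central_projection ip N p & x = Psi p) /\
  (finite_dim N -> forall x, extreme_points B x ->
     ((exists2 p, central_projection ip N p & x = Psi p) <->
      isolated (extreme_points B) x)).
Proof.
move=> N Psi B.
have [vN NM bN _] : [/\ von_neumann_algebra ip N, N `<=` M, range b `<=` N &
    forall A, von_neumann_subalgebra ip M A -> range b `<=` A -> N `<=` A].
  by apply: (generated_vnaP ip_norm M_vna) => _ [i _ <-]; case: (b_sa i).
have BE : B = spectral_scale ip N tau b.
  apply: (spectral_scale_sub ip_norm M_vna tau_trace b_sa vN NM) => i.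
  by apply: bN; exists i.
rewrite BE; split=> [x iso|fd x ext].
  exact: (isolated_central ip_norm M_vna tau_trace b_sa).
split=> [[p cp xp]|iso].
  exact: (central_isolated ip_norm M_vna tau_trace b_sa fd ext cp).
exact: (isolated_central ip_norm M_vna tau_trace b_sa).
Qed.
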